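(* Let $b>0$, let $q:[0,b]\to\mathbb{C}$ be continuous, let $f$ be a non-vanishing solution of $f''-qf=0$ on $[0,b]$ with $f(0)=1$, $h:=f'(0)$, and let $c(\omega,x)$, $s(\omega,x)$, $\gamma_n$, $K_1$, $K_{1,N}$ be as defined in the context. Put $$\overset{\circ}{c}_N(\omega,x)=-\omega\sin\omega x+\left(h+\frac12\int_0^xq(s)\,ds\right)\cos\omega x+2\sum_{n=0}^{[N/2]}(-1)^n\gamma_{2n}(x)j_{2n}(\omega x),$$ $$\overset{\circ}{s}_N(\omega,x)=\omega\cos\omega x+\frac12\left(\int_0^xq(s)\,ds\right)\sin\omega x+2\sum_{n=0}^{[(N-1)/2]}(-1)^n\gamma_{2n+1}(x)j_{2n+1}(\omega x).$$ Let $\varepsilon_N$ be a nonnegative function such that $|K_1(x,t)-K_{1,N}(x,t)|\le\varepsilon_N(x)$ for $0<x\le b$, $|t|\le x$. Then, with primes denoting derivatives with respect to $x$, $$|c'(\omega,x)-\overset{\circ}{c}_N(\omega,x)|\le2|x|\varepsilon_N(x)\quad\text{and}\quad|s'(\omega,x)-\overset{\circ}{s}_N(\omega,x)|\le2|x|\varepsilon_N(x)$$ for any $\omega\in\mathbb{R}$, $\omega\ne0$, and $$|c'(\omega,x)-\overset{\circ}{c}_N(\omega,x)|\le\frac{2\varepsilon_N(x)\sinh(Cx)}{C}\quad\text{and}\quad|s'(\omega,x)-\overset{\circ}{s}_N(\omega,x)|\le\frac{2\varepsilon_N(x)\sinh(Cx)}{C}$$ for any $\omega\in\mathbb{C}$,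 $\omega\ne0$, belonging to the strip $|\operatorname{Im}\omega|\le C$, $C\ge0$ (for $C=0$ the quotient $\sinh(Cx)/C$ is understood as its limit $x$).
   Context: $P_n(x)=\sum_{k=0}^nl_{k,n}x^k$ is the Legendre polynomial of degree $n$; $j_k(z)=\sqrt{\pi/(2z)}\,J_{k+1/2}(z)$ is the spherical Bessel function of order $k$; $[a]$ is the largest integer $\le a$. Transmutation kernel: $K$ is the (unique continuous) function on $\{(x,t):0\le x\le b,\ |t|\le x\}$ satisfying $$K(x,t)=\frac h2+\frac12\int_0^{\frac{x+t}{2}}q(s)\,ds+\int_0^{\frac{x+t}{2}}\int_0^{\frac{x-t}{2}}q(\alpha+\beta)K(\alpha+\beta,\alpha-\beta)\,d\beta\,d\alpha .$$ It is the $C^1$ kernel of the transmutation operator $Tu(x)=u(x)+\int_{-x}^{x}K(x,t)u(t)\,dt$, which satisfies $\left(-\frac{d^2}{dx^2}+q\right)T[u]=T[-u'']$ for $u\in C^2$ and $T[1]=f$. $K_1(x,t)$ is the partial derivative of $K$ with respect to the first variable. Solutions of $-y''+qy=\omega^2y$: $c(\omega,x):=\cos\omega x+\int_{-x}^xK(x,t)\cos\omega t\,dt$ and $s(\omega,x):=\sin\omega x+\int_{-x}^xK(x,t)\sin\omega t\,dt$. Formal powers: $X^{(0)}\equiv\widetilde X^{(0)}\equiv1$ and, for $n\ge1$, $$X^{(n)}(x)=n\int_0^xX^{(n-1)}(s)\,(f^2(s))^{(-1)^n}ds,\qquad \widetilde X^{(n)}(x)=n\int_0^x\widetilde X^{(n-1)}(s)\,(f^2(s))^{(-1)^{n-1}}ds;$$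 $\varphi_k=fX^{(k)}$ for odd $k$ and $\varphi_k=f\widetilde X^{(k)}$ for even $k$. Coefficients, for $x\in(0,b]$: $$\gamma_n(x)=\frac{2n+1}{2}\left(\sum_{k=0}^n\frac{l_{k,n}\varphi_k'(x)}{x^k}-\frac{n(n+1)}{2x}-\frac12\int_0^xq(s)\,ds-\frac h2\bigl(1+(-1)^n\bigr)\right),$$ and $K_{1,N}(x,t)=\sum_{j=0}^N\frac{\gamma_j(x)}{x}P_j\!\left(\frac tx\right)$. *)

(* Defs.v *)
From Stdlib Require Import Reals Factorial ClassicalEpsilon.
From Coquelicot Require Import Coquelicot.
Open Scope R_scope.

(* Stdlib reals with Coquelicot.  Data given on [0, b] (or on a triangle) are
   total functions constrained only there; continuity, derivatives and
   integrals below never look outside that domain. *)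

Definition Icc (b : R) : R -> Prop := fun x => 0 <= x <= b.

Definition CInt (u : R -> C) (a b : R) : C :=
  RInt (V := C_R_CompleteNormedModule) u a b.

(* Derivative relative to the interval [0, b]: one-sided at 0 and at b.  It is
   unique when 0 < b and x lies in [0, b]. *)
Definition is_deriv (b : R) (u : R -> C) (x : R) (l : C) : Prop :=
  filterdiff (U := R_NormedModule) (V := C_R_NormedModule)
    u (within (Icc b) (locally x))
    (fun y => scal (V := C_R_NormedModule) y l).

Definition ex_deriv (b : R) (u : R -> C) (x : R) : Prop :=
  exists l, is_deriv b u x l.

Definition deriv (b : R) (u : R -> C) (x : R) : C :=
  epsilon (inhabits (RtoC 0)) (is_deriv b u x).

(* Elementary functions of a complex variable *)

Definition Cexp (z : C) : C :=
  (exp (Re z) * cos (Im z), exp (Re z) * sin (Im z)).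

Definition Ccos (z : C) : C := ((Cexp (Ci * z) + Cexp (- (Ci * z))) / 2)%C.

Definition Csin (z : C) : C :=
  ((Cexp (Ci * z) - Cexp (- (Ci * z))) / (2 * Ci))%C.

(* Principal argument, in (-PI, PI], of z <> 0 *)
Definition Carg (z : C) : R :=
  if Rle_dec 0 (Im z) then acos (Re z / Cmod z) else - acos (Re z / Cmod z).

(* Principal branch of z ^ a for z <> 0 and a real exponent a *)
Definition Cpower (z : C) (a : R) : C :=
  Cexp (RtoC a * (ln (Cmod z), Carg z))%C.

Definition CSeries (a : nat -> C) : C :=
  (Series (fun m => Re (a m)), Series (fun m => Im (a m))).

(* Euler's integral, for 0 < a *)
Definition Gamma (a : R) : R :=
  RInt_gen (fun t => Rpower t (a - 1) * exp (- t))
    (at_right 0) (Rbar_locally p_infty).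

Definition besselJ (nu : R) (z : C) : C :=
  (Cpower (z / 2) nu *
   CSeries (fun m =>
     (- (z * z / 4)) ^ m /
     RtoC (INR (fact m) * Gamma (nu + INR m + 1))))%C.

(* sqrt(PI/(2z)) is written (2z/PI)^(-1/2), so that both half-integer powers
   use the same branch of log z and j_k agrees with the usual entire function
   also on the negative real axis; taking the principal square root of
   PI/(2z) there would change the sign. *)
Definition sphj (k : nat) (z : C) : C :=
  (Cpower (2 * z / RtoC PI) (- / 2) * besselJ (INR k + / 2) z)%C.

(* legendre_coef n k is the coefficient of x^k in P_n, obtained from Bonnet's
   recurrence (p+1) P_{p+1} = (2p+1) x P_p - p P_{p-1}, P_0 = 1, P_1 = x. *)
Fixpoint legendre_coef (n k : nat) {struct n} : R :=
  match n with
  | O => match k with O => 1 | _ => 0 end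
  | S O => match k with S O => 1 | _ => 0 end
  | S (S m as p) =>
      ((2 * INR p + 1) *
         match k with O => 0 | S k' => legendre_coef p k' end
       - INR p * legendre_coef m k) / (INR p + 1)
  end.

Definition legendre (n : nat) (x : R) : R :=
  sum_n (fun k => legendre_coef n k * x ^ k) n.

(* f is a solution of f'' - q f = 0 on [0, b] *)
Definition schrodinger_sol (b : R) (q f : R -> C) : Prop :=
  exists f1 : R -> C, forall x, 0 <= x <= b ->
    is_deriv b f x (f1 x) /\ is_deriv b f1 x (q x * f x)%C.

(* (f^2)^{(-1)^n} *)
Definition sq_alt (f : R -> C) (n : nat) (s : R) : C :=
  if Nat.even n then (f s ^ 2)%C else (/ (f s ^ 2))%C.

Fixpoint formalX (f : R -> C) (n : nat) (x : R) : C :=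
  match n with
  | O => RtoC 1
  | S m =>
      (RtoC (INR n) * CInt (fun s => formalX f m s * sq_alt f n s) 0 x)%C
  end.

Fixpoint formalXt (f : R -> C) (n : nat) (x : R) : C :=
  match n with
  | O => RtoC 1
  | S m =>
      (RtoC (INR n) * CInt (fun s => formalXt f m s * sq_alt f m s) 0 x)%C
  end.

Definition phi (f : R -> C) (k : nat) (x : R) : C :=
  if Nat.odd k then (f x * formalX f k x)%C else (f x * formalXt f k x)%C.

Definition gamma (b : R) (q f : R -> C) (h : C) (n : nat) (x : R) : C :=
  (RtoC ((2 * INR n + 1) / 2) *
   (sum_n (fun k =>
      RtoC (legendre_coef n k) * deriv b (phi f k) x / RtoC (x ^ k)) n
    - RtoC (INR n * (INR n + 1) / (2 * x))
    - / 2 * CInt q 0 x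
    - h / 2 * RtoC (1 + (-1) ^ n)))%C.

Definition K1N (b : R) (q f : R -> C) (h : C) (N : nat) (x t : R) : C :=
  sum_n (fun j =>
    gamma b q f h j x / RtoC x * RtoC (legendre j (t / x)))%C N.

Definition triangle (b : R) : R * R -> Prop :=
  fun p => 0 <= fst p <= b /\ Rabs (snd p) <= fst p.

Definition transmutation_kernel
    (b : R) (q : R -> C) (h : C) (K : R -> R -> C) : Prop :=
  continuous_on (triangle b) (fun p => K (fst p) (snd p)) /\
  forall x t, 0 <= x <= b -> Rabs t <= x ->
    K x t =
      (h / 2 + / 2 * CInt q 0 ((x + t) / 2) +
       CInt (fun al =>
         CInt (fun be => q (al + be)%R * K (al + be)%R (al - be)%R)
           0 ((x - t) / 2))
         0 ((x + t) / 2))%C.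

(* K1 is the first partial derivative of the C^1 function K on the closed
   triangle: the partial derivative in the interior, extended continuously
   (at the corners (b, b) and (b, -b) the line t = const meets the triangle in
   a single point, so a one-sided derivative makes no sense there). *)
Definition first_partial (b : R) (K K1 : R -> R -> C) : Prop :=
  continuous_on (triangle b) (fun p => K1 (fst p) (snd p)) /\
  forall x t, x < b -> Rabs t < x ->
    is_derive (V := C_R_NormedModule) (fun y => K y t) x (K1 x t).

Definition csol (K : R -> R -> C) (w : C) (x : R) : C :=
  (Ccos (w * x) + CInt (fun t => K x t * Ccos (w * t)) (- x) x)%C.

Definition ssol (K : R -> R -> C) (w : C) (x : R) : C :=
  (Csin (w * x) + CInt (fun t => K x t * Csin (w * t)) (- x) x)%C.

Definition c_ring (b : R) (q f : R -> C) (h : C) (N : nat) (w : C) (x : R)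
    : C :=
  (- (w * Csin (w * x)) + (h + / 2 * CInt q 0 x) * Ccos (w * x) +
   2 * sum_n (fun n =>
     RtoC ((-1) ^ n) * gamma b q f h (2 * n) x * sphj (2 * n) (w * x))
     (N / 2))%C.

(* For N = 0 the upper limit [(N-1)/2] is -1 and the sum is empty. *)
Definition s_ring (b : R) (q f : R -> C) (h : C) (N : nat) (w : C) (x : R)
    : C :=
  (w * Ccos (w * x) + / 2 * CInt q 0 x * Csin (w * x) +
   2 * match N with
       | O => RtoC 0
       | S M =>
           sum_n (fun n =>
             RtoC ((-1) ^ n) * gamma b q f h (2 * n + 1) x *
             sphj (2 * n + 1) (w * x))
             (M / 2)
       end)%C.

(* sinh(A x) / A, understood as its limit x at A = 0 *)
Definition sinh_quot (A x : R) : R :=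
  if Req_EM_T A 0 then x else sinh (A * x) / A.

(* Main.v *)
Require Import Defs.
From Stdlib Require Import Reals Lra Lia Arith ClassicalEpsilon FunctionalExtensionality.
From Coquelicot Require Import Coquelicot.
Open Scope R_scope.

(** Leibniz' rule gives

      [c'(w, x) = - w sin (w x) + (K(x, x) + K(x, -x)) cos (w x)
                  + int_{-x}^{x} K1(x, t) cos (w t) dt],

    and similarly for [s] with [K(x, x) - K(x, -x)] in front of the sine.  By the integral
    equation, [K(x, x)] is [h / 2] plus half the integral of [q], and [K(x, -x) = h / 2]
    ([kernel_diag]), so these boundary terms are the explicit terms of the approximations.
    The sums of Bessel functions are the same integrals with the truncated Legendre expansion
    in place of [K1], because

      [int_{-1}^{1} P_n(u) exp (i z u) du = 2 i^n j_n(z)]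

    ([fourier_legendre_sphj]).  Hence the error is the integral of
    [(K1 - K1N)(x, t) cos (w t)], at most [eps] times the integral of [cosh (A t)] over
    [-x, x], which is [2 sinh (A x) / A] ([transform_estimate]).

    Two ingredients carry the weight.  The integral formula is proved by expanding the
    exponential, integrating termwise ([is_series_RInt_PSeries]), evaluating the moments of
    the Legendre polynomials by Bonnet's recurrence ([legendre_moment_spec]), and comparing
    with the Bessel series, whose coefficients contain Gamma at half-integers; the latter come
    from the Gaussian integral ([Gamma_half]).  Leibniz' rule is not immediate because [K] lives on a
    triangle and is differentiable only inside it; it is obtained by extending [K] to the plane
    through its derivative ([is_derive_RInt_triangle]). *)

(** * The Gamma function at half-integers *)

(** Library lemmas state equations over the carrier of an algebraic structure; [ring] and
    [field] only recognise them once that carrier is written as [R] or [C]. *)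
Ltac real_eq := match goal with |- @eq _ ?a ?b => change (@eq R a b) end.

Ltac complex_eq := match goal with |- @eq _ ?a ?b => change (@eq C a b) end.

Definition gauss (s : R) : R := exp (- (s * s)).

Lemma is_derive_gauss (s : R) : is_derive gauss s (- (2 * s) * gauss s).
Proof. unfold gauss; auto_derive; [trivial | ring]. Qed.

Lemma continuous_of_derivable (u : R -> R) (x : R) :
  ex_derive u x -> continuous u x.
Proof. intros H; apply (ex_derive_continuous (V := R_NormedModule)); exact H. Qed.

Lemma continuous_gauss (s : R) : continuous gauss s.
Proof.
  apply continuous_of_derivable; eexists; apply is_derive_gauss.
Qed.

Lemma ex_RInt_of_continuous (u : R -> R) (a b : R) :
  (forall x, continuous u x) -> ex_RInt u a b.
Proof.
  intros H; apply (ex_RInt_continuous (V := R_CompleteNormedModule)); intros; apply H.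
Qed.

Lemma exp_pow (n : nat) (y : R) : exp y ^ n = exp (INR n * y).
Proof.
  induction n as [| n IH]; [now rewrite Rmult_0_l, exp_0 |].
  rewrite S_INR, <- tech_pow_Rmult, IH, <- exp_plus; f_equal; ring.
Qed.

Lemma derivative_zero_const (F : R -> R) (x y : R) :
  (forall z, is_derive F z 0) -> F x = F y.
Proof.
  intros D; destruct (MVT_gen F x y (fun _ => 0)) as [c [_ E]].
  - intros; apply D.
  - intros z _; apply continuity_pt_filterlim, continuous_of_derivable; eexists; apply D.
  - lra.
Qed.

(** The classical companion of the Gaussian integral: its derivative is the opposite of the
    derivative of [(RInt gauss 0 y) ^ 2], and it vanishes at infinity. *)
Definition gauss_aux (y : R) : R :=
  RInt (fun t => exp (- (y * y) * (1 + t * t)) / (1 + t * t)) 0 1.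

Lemma one_plus_sq_pos (t : R) : 0 < 1 + t * t.
Proof. nra. Qed.

Lemma is_derive_gauss_kernel (y t : R) :
  is_derive (fun y => exp (- (y * y) * (1 + t * t)) / (1 + t * t)) y
    (- (2 * y) * exp (- (y * y) * (1 + t * t))).
Proof.
  pose proof (one_plus_sq_pos t).
  auto_derive; [lra | field; lra].
Qed.

Lemma continuous_gauss_kernel (y t : R) :
  continuous (fun t => exp (- (y * y) * (1 + t * t)) / (1 + t * t)) t.
Proof.
  apply continuous_of_derivable; auto_derive.
  pose proof (one_plus_sq_pos t); lra.
Qed.

(** Differentiation under the integral cancels the factor [1 + t * t]; what remains is
    [gauss (y * t)], which the substitution [s = y * t] turns into [RInt gauss 0 y]. *)
Lemma is_derive_gauss_aux (y : R) :
  is_derive gauss_aux y (- 2 * gauss y * RInt gauss 0 y).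
Proof.
  assert (E : RInt (fun t => Derive (fun u => exp (- (u * u) * (1 + t * t)) / (1 + t * t)) y) 0 1
    = - 2 * gauss y * RInt gauss 0 y).
  { apply is_RInt_unique.
    apply (is_RInt_ext (fun t => scal (-2 * gauss y) (scal y (gauss (y * t + 0))))).
    - intros t _; symmetry.
      erewrite is_derive_unique by apply is_derive_gauss_kernel.
      unfold gauss, scal; simpl; unfold mult; simpl.
      replace (- (y * y) * (1 + t * t))
        with (- (y * y) + - ((y * t + 0) * (y * t + 0))) by ring.
      rewrite exp_plus; real_eq; ring.
    - apply (is_RInt_scal (V := R_NormedModule) (fun t => scal y (gauss (y * t + 0)))).
      apply (is_RInt_comp_lin (V := R_NormedModule) gauss y 0 0 1).
      replace (y * 0 + 0) with 0 by ring; replace (y * 1 + 0) with y by ring.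
      apply (RInt_correct (V := R_CompleteNormedModule)).
      apply ex_RInt_of_continuous, continuous_gauss. }
  rewrite <- E.
  apply is_derive_RInt_param.
  - apply filter_forall; intros z t _; eexists; apply is_derive_gauss_kernel.
  - intros t _.
    apply (continuity_2d_pt_ext (fun u v => - (2 * u) * exp (- (u * u) * (1 + v * v)))).
    { intros u v; symmetry; apply is_derive_unique, is_derive_gauss_kernel. }
    apply continuity_2d_pt_mult.
    + apply (continuity_1d_2d_pt_comp (fun u => - (2 * u)) (fun u v => u)).
      * apply derivable_continuous_pt, ex_derive_Reals_0; auto_derive; trivial.
      * apply continuity_2d_pt_id1.
    + apply (continuity_1d_2d_pt_comp exp (fun u v => - (u * u) * (1 + v * v))).
      * apply derivable_continuous_pt, derivable_pt_exp.
      * apply continuity_2d_pt_mult.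
        -- apply continuity_2d_pt_opp, continuity_2d_pt_mult; apply continuity_2d_pt_id1.
        -- apply continuity_2d_pt_plus; [apply continuity_2d_pt_const |].
           apply continuity_2d_pt_mult; apply continuity_2d_pt_id2.
  - apply filter_forall; intros z.
    apply ex_RInt_of_continuous, continuous_gauss_kernel.
Qed.

Lemma gauss_aux_0 : gauss_aux 0 = PI / 4.
Proof.
  unfold gauss_aux.
  replace (PI / 4) with (minus (atan 1) (atan 0))
    by (rewrite atan_0, atan_1; unfold minus, plus, opp; simpl; ring).
  apply is_RInt_unique.
  apply (is_RInt_ext (fun t => / (1 + t ^ 2))).
  { intros t _; replace (- (0 * 0) * (1 + t * t)) with 0 by ring.
    rewrite exp_0; pose proof (one_plus_sq_pos t); real_eq; field; lra. }
  apply (is_RInt_derive (V := R_CompleteNormedModule) atan).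
  - intros t _; apply is_derive_Reals.
    apply derivable_pt_lim_atan.
  - intros t _; apply continuous_of_derivable; auto_derive.
    pose proof (one_plus_sq_pos t); lra.
Qed.

Lemma gauss_aux_bounds (y : R) : 0 <= gauss_aux y <= gauss y.
Proof.
  unfold gauss_aux; split.
  - apply RInt_ge_0; [lra | |].
    + apply ex_RInt_of_continuous, continuous_gauss_kernel.
    + intros t _; apply Rdiv_le_0_compat; [left; apply exp_pos | apply one_plus_sq_pos].
  - replace (gauss y) with (RInt (fun _ => gauss y) 0 1).
    2: { rewrite RInt_const; unfold scal; simpl; unfold mult; simpl; ring. }
    apply RInt_le; [lra | | apply ex_RInt_const |].
    + apply ex_RInt_of_continuous, continuous_gauss_kernel.
    + intros t _; pose proof (one_plus_sq_pos t).
      apply Rle_div_l; [lra |].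
      unfold gauss.
      assert (exp (- (y * y) * (1 + t * t)) <= exp (- (y * y))).
      { destruct (Rle_lt_or_eq_dec (- (y * y) * (1 + t * t)) (- (y * y))) as [L | ->]; [nra | | lra].
        left; apply exp_increasing, L. }
      pose proof (exp_pos (- (y * y))); nra.
Qed.

Lemma is_derive_RInt_gauss (y : R) : is_derive (fun y => RInt gauss 0 y) y (gauss y).
Proof.
  apply (is_derive_RInt (V := R_NormedModule) gauss _ 0).
  - apply filter_forall; intros z.
    apply (RInt_correct (V := R_CompleteNormedModule)), ex_RInt_of_continuous, continuous_gauss.
  - apply continuous_gauss.
Qed.

(** The left-hand side has zero derivative, and at [0] it equals [atan 1 = PI / 4]. *)
Lemma gauss_square (y : R) : RInt gauss 0 y * RInt gauss 0 y + gauss_aux y = PI / 4.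
Proof.
  set (F := fun y => RInt gauss 0 y * RInt gauss 0 y + gauss_aux y).
  assert (D : forall z, is_derive F z 0).
  { intros z.
    assert (H : is_derive F z (plus (gauss z * RInt gauss 0 z + RInt gauss 0 z * gauss z)
                                    (- 2 * gauss z * RInt gauss 0 z))).
    { apply (is_derive_plus (V := R_NormedModule)); [| apply is_derive_gauss_aux].
      apply (is_derive_mult (fun y => RInt gauss 0 y)); try apply is_derive_RInt_gauss.
      intros; apply Rmult_comm. }
    replace 0 with (plus (gauss z * RInt gauss 0 z + RInt gauss 0 z * gauss z)
                         (- 2 * gauss z * RInt gauss 0 z)); [exact H |].
    unfold plus; simpl; ring. }
  transitivity (F 0); [exact (derivative_zero_const F y 0 D) |].
  unfold F; rewrite RInt_point, gauss_aux_0; unfold zero; simpl; ring.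
Qed.

(** For [y >= n + 1], [y ^ n <= exp (n y)] while [gauss y <= exp (- (n + 1) y)], so the
    product is at most [exp (- y)]. *)
Lemma is_lim_gauss_mult_pow (n : nat) :
  is_lim (fun y => y ^ n * gauss y) p_infty 0.
Proof.
  apply (is_lim_le_le_loc (fun _ => 0) (fun y => exp (- y))).
  - exists (INR n + 1); intros y Hy; pose proof (pos_INR n).
    assert (P : 0 <= y ^ n <= exp (INR n * y)).
    { split; [apply pow_le; lra |].
      rewrite <- exp_pow.
      apply pow_incr; split; [lra |].
      pose proof (exp_ineq1_le y); lra. }
    assert (G : gauss y <= exp (- (INR n * y) + - y)).
    { unfold gauss; left; apply exp_increasing; nra. }
    rewrite exp_plus in G.
    assert (E : exp (INR n * y) * exp (- (INR n * y)) = 1).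
    { rewrite <- exp_plus, Rplus_opp_r; apply exp_0. }
    pose proof (exp_pos (- (y * y))) as G0; fold (gauss y) in G0.
    pose proof (exp_pos (INR n * y)); pose proof (exp_pos (- y)).
    split; [nra |].
    apply Rle_trans with (exp (INR n * y) * (exp (- (INR n * y)) * exp (- y))).
    + apply Rmult_le_compat; lra.
    + rewrite <- Rmult_assoc, E; lra.
  - apply is_lim_const.
  - apply (is_lim_comp exp Ropp p_infty 0 m_infty).
    + apply is_lim_exp_m.
    + apply (is_lim_opp (fun y => y) p_infty p_infty), is_lim_id.
    + exists 0; intros; discriminate.
Qed.

Lemma gauss_integral : is_lim (fun y => RInt gauss 0 y) p_infty (sqrt PI / 2).
Proof.
  assert (L : is_lim (fun y => sqrt (PI / 4 - gauss_aux y)) p_infty (sqrt PI / 2)).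
  { replace (sqrt PI / 2) with (sqrt (PI / 4 - 0)).
    2: { rewrite Rminus_0_r, sqrt_div_alt by lra.
         replace 4 with (2 * 2) by ring; rewrite sqrt_square by lra; reflexivity. }
    apply (is_lim_comp_continuous (fun y => PI / 4 - gauss_aux y) sqrt _ (PI / 4 - 0)).
    - apply (is_lim_minus _ _ _ (PI / 4) 0); [apply is_lim_const | | reflexivity].
      apply (is_lim_le_le_loc (fun _ => 0) (fun y => y ^ 0 * gauss y)).
      + exists 0; intros y _; pose proof (gauss_aux_bounds y); simpl; lra.
      + apply is_lim_const.
      + apply is_lim_gauss_mult_pow.
    - apply continuous_sqrt. }
  eapply is_lim_ext_loc; [| exact L].
  exists 0; intros y Hy.
  rewrite <- (gauss_square y).
  replace (RInt gauss 0 y * RInt gauss 0 y + gauss_aux y - gauss_aux y)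
    with (RInt gauss 0 y * RInt gauss 0 y) by ring.
  apply sqrt_square.
  apply RInt_ge_0; [lra | |].
  - apply ex_RInt_of_continuous, continuous_gauss.
  - intros t _; left; apply exp_pos.
Qed.

(** [half_fact n] is Gamma(n + 1/2) / sqrt PI. *)
Fixpoint half_fact (n : nat) : R :=
  match n with
  | O => 1
  | S m => (INR m + / 2) * half_fact m
  end.

Lemma half_fact_pos (n : nat) : 0 < half_fact n.
Proof.
  induction n as [| n IH]; simpl; [lra |].
  pose proof (pos_INR n); apply Rmult_lt_0_compat; lra.
Qed.

Definition gauss_moment (n : nat) (y : R) : R :=
  RInt (fun s => 2 * (s ^ (2 * n) * gauss s)) 0 y.

Lemma continuous_gauss_moment_integrand (n : nat) (s : R) :
  continuous (fun s => 2 * (s ^ (2 * n) * gauss s)) s.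
Proof.
  apply continuous_of_derivable; unfold gauss; auto_derive; trivial.
Qed.

Lemma is_derive_gauss_moment (n : nat) (y : R) :
  is_derive (gauss_moment n) y (2 * (y ^ (2 * n) * gauss y)).
Proof.
  apply (is_derive_RInt (V := R_NormedModule) (fun s => 2 * (s ^ (2 * n) * gauss s)) _ 0).
  - apply filter_forall; intros z.
    apply (RInt_correct (V := R_CompleteNormedModule)), ex_RInt_of_continuous.
    apply continuous_gauss_moment_integrand.
  - apply continuous_gauss_moment_integrand.
Qed.

(** Integration by parts, in the form: the difference of the two sides has zero derivative
    and vanishes at [0]. *)
Lemma gauss_moment_succ (n : nat) (y : R) :
  gauss_moment (S n) y
  = (INR n + / 2) * gauss_moment n y - y ^ (2 * n + 1) * gauss y.
Proof.
  set (F := fun y => gauss_moment (S n) y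
                     - (INR n + / 2) * gauss_moment n y + y ^ (2 * n + 1) * gauss y).
  assert (D : forall z, is_derive F z 0).
  { intros z; unfold F.
    pose proof (is_derive_gauss_moment n z) as D0.
    pose proof (is_derive_gauss_moment (S n) z) as D1.
    auto_derive.
    - repeat split; try (eexists; eassumption).
      eexists; apply is_derive_gauss.
    - replace (Derive (fun x => gauss_moment n x) z) with (2 * (z ^ (2 * n) * gauss z))
        by (symmetry; exact (is_derive_unique _ _ _ D0)).
      replace (Derive (fun x => gauss_moment (S n) x) z) with (2 * (z ^ (2 * S n) * gauss z))
        by (symmetry; exact (is_derive_unique _ _ _ D1)).
      replace (Derive (fun x => gauss x) z) with (- (2 * z) * gauss z)
        by (symmetry; exact (is_derive_unique _ _ _ (is_derive_gauss z))).
      replace (2 * S n)%nat with (S (S (2 * n))) by lia.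
      replace (n + (n + 0) + 1)%nat with (S (2 * n)) by lia.
      rewrite S_INR, mult_INR; simpl (pred _); simpl (INR 2).
      rewrite <- !tech_pow_Rmult; replace (n + (n + 0))%nat with (2 * n)%nat by lia; real_eq; field. }
  assert (E0 : F 0 = 0).
  { unfold F, gauss_moment; rewrite !RInt_point; unfold zero; simpl.
    rewrite pow_i by lia; ring. }
  pose proof (derivative_zero_const F y 0 D) as E; unfold F in *; lra.
Qed.

Lemma is_lim_gauss_moment (n : nat) :
  is_lim (gauss_moment n) p_infty (sqrt PI * half_fact n).
Proof.
  induction n as [| n IH].
  - apply (is_lim_ext (fun y => 2 * RInt gauss 0 y)).
    + intros y; symmetry; apply is_RInt_unique.
      apply (is_RInt_ext (fun s => scal 2 (gauss s))).
      * intros s _; unfold scal; simpl; unfold mult; simpl; real_eq; ring.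
      * apply (is_RInt_scal (V := R_NormedModule)).
        apply (RInt_correct (V := R_CompleteNormedModule)), ex_RInt_of_continuous, continuous_gauss.
    + replace (Finite (sqrt PI * half_fact 0)) with (Rbar_mult 2 (sqrt PI / 2))
        by (simpl; f_equal; field).
      apply is_lim_scal_l, gauss_integral.
  - apply (is_lim_ext (fun y => (INR n + / 2) * gauss_moment n y - y ^ (2 * n + 1) * gauss y)).
    { intros y; symmetry; apply gauss_moment_succ. }
    replace (sqrt PI * half_fact (S n))
      with ((INR n + / 2) * (sqrt PI * half_fact n) - 0) by (simpl; ring).
    apply is_lim_minus'; [| apply is_lim_gauss_mult_pow].
    apply (is_lim_scal_l (gauss_moment n) (INR n + / 2) p_infty (sqrt PI * half_fact n)), IH.
Qed.

(** The substitution [t = s ^ 2]: the integrand of Euler's integral for Gamma(n + 1/2) has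
    [gauss_moment n (sqrt t)] as a primitive on (0, +oo). *)
Lemma is_derive_gauss_moment_sqrt (n : nat) (t : R) : 0 < t ->
  is_derive (fun t => gauss_moment n (sqrt t)) t (Rpower t (INR n + / 2 - 1) * exp (- t)).
Proof.
  intros Ht.
  pose proof (sqrt_lt_R0 t Ht) as Hs.
  pose proof (sqrt_sqrt t (Rlt_le _ _ Ht)) as Hss.
  assert (D : is_derive sqrt t (/ (2 * sqrt t))) by (auto_derive; [trivial | field; lra]).
  pose proof (is_derive_comp (gauss_moment n) sqrt t _ _
    (is_derive_gauss_moment n (sqrt t)) D) as H.
  replace (Rpower t (INR n + / 2 - 1) * exp (- t))
    with (scal (/ (2 * sqrt t)) (2 * (sqrt t ^ (2 * n) * gauss (sqrt t)))); [exact H |].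
  unfold scal; simpl; unfold mult; simpl; unfold gauss; rewrite Hss.
  replace (INR n + / 2 - 1) with (INR n + - / 2) by field.
  rewrite Rpower_plus, Rpower_pow, Rpower_Ropp, Rpower_sqrt by exact Ht.
  replace (n + (n + 0))%nat with (2 * n)%nat by lia.
  rewrite pow_mult; replace (sqrt t ^ 2) with t by (rewrite <- Hss at 1; ring).
  field; lra.
Qed.

(** Euler's integral is improper at both ends; with an explicit primitive it reduces to the
    limits of that primitive at 0 and at infinity. *)
Lemma Gamma_half (n : nat) : Gamma (INR n + / 2) = sqrt PI * half_fact n.
Proof.
  unfold Gamma.
  apply (is_RInt_gen_unique (V := R_CompleteNormedModule)).
  set (F := fun t => gauss_moment n (sqrt t)).
  assert (D : forall t, 0 < t -> Derive F t = Rpower t (INR n + / 2 - 1) * exp (- t)).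
  { intros t Ht; apply is_derive_unique, is_derive_gauss_moment_sqrt, Ht. }
  assert (Pos : filter_prod (at_right 0) (Rbar_locally p_infty)
            (fun ab : R * R => forall x, Rmin (fst ab) (snd ab) <= x -> 0 < x)).
  { exists (fun a => 0 < a) (fun c => 0 < c).
    - exists (mkposreal 1 Rlt_0_1); intros y _ Hy; exact Hy.
    - exists 0; intros y Hy; exact Hy.
    - intros a c Ha Hc x Hx; simpl in Hx.
      pose proof (Rmin_glb_lt a c 0 Ha Hc); lra. }
  replace (sqrt PI * half_fact n) with (sqrt PI * half_fact n - 0) by ring.
  apply (is_RInt_gen_ext (Derive F)).
  { refine (filter_imp _ _ _ Pos); intros ab H x Hx; apply D, H; lra. }
  apply is_RInt_gen_Derive.
  - refine (filter_imp _ _ _ Pos); intros ab H x [Hx _].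
    eexists; apply is_derive_gauss_moment_sqrt, (H x Hx).
  - refine (filter_imp _ _ _ Pos); intros ab H x [Hx _].
    specialize (H x Hx).
    apply (continuous_ext_loc _ (fun t => Rpower t (INR n + / 2 - 1) * exp (- t))).
    + exists (mkposreal x H); intros y Hy; symmetry; apply D.
      apply Rabs_lt_between in Hy; unfold minus, plus, opp in Hy; simpl in Hy; lra.
    + apply continuous_of_derivable; unfold Rpower; auto_derive; exact H.
  - replace 0 with (F 0) at 2.
    2: { unfold F, gauss_moment; rewrite sqrt_0, RInt_point; reflexivity. }
    apply (filterlim_filter_le_1 (F := locally 0)); [apply filter_le_within |].
    apply (continuous_comp sqrt (gauss_moment n)); [apply continuous_sqrt |].
    apply continuous_of_derivable; eexists; apply is_derive_gauss_moment.
  - apply (filterlim_comp _ _ _ sqrt (gauss_moment n) _ (Rbar_locally p_infty)).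
    + apply filterlim_sqrt_p.
    + apply (is_lim_gauss_moment n).
Qed.

(** * Moments of the Legendre polynomials *)

Lemma legendre_coef_eq_0 (n : nat) :
  forall k, (n < k)%nat -> legendre_coef n k = 0.
Proof.
  induction n as [n IH] using lt_wf_ind; intros k Hk.
  destruct n as [| [| m]].
  - destruct k; [lia | reflexivity].
  - destruct k as [| [| k]]; [lia | lia | reflexivity].
  - destruct k as [| k]; [lia |].
    change (legendre_coef (S (S m)) (S k)) with
      (((2 * INR (S m) + 1) * legendre_coef (S m) k
        - INR (S m) * legendre_coef m (S k)) / (INR (S m) + 1)).
    rewrite (IH (S m)), (IH m) by lia.
    unfold Rdiv; ring.
Qed.

Lemma sum_n_succ_R (a : nat -> R) (n : nat) : sum_n a (S n) = sum_n a n + a (S n).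
Proof. exact (sum_Sn a n). Qed.

(** Summing beyond the degree adds only zeros, which lets the three sums of different lengths
    in Bonnet's recurrence be compared term by term. *)
Lemma legendre_sum_n (n j : nat) (u : R) : (n <= j)%nat ->
  sum_n (fun k => legendre_coef n k * u ^ k) j = legendre n u.
Proof.
  intros H; induction H as [| j H IH]; [reflexivity |].
  rewrite sum_n_succ_R, IH, legendre_coef_eq_0 by lia; real_eq; ring.
Qed.

Lemma sum_n_shift (a : nat -> R) (u : R) (j : nat) :
  sum_n (fun k => match k with O => 0 | S k' => a k' end * u ^ k) (S j)
  = u * sum_n (fun k => a k * u ^ k) j.
Proof.
  induction j as [| j IH]; [rewrite sum_n_succ_R, !sum_O; simpl; real_eq; ring |].
  rewrite sum_n_succ_R, IH, sum_n_succ_R; simpl; real_eq; ring.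
Qed.

Lemma sum_n_lin (a c : nat -> R) (al be : R) (j : nat) :
  sum_n (fun k => al * a k + be * c k) j = al * sum_n a j + be * sum_n c j.
Proof.
  induction j as [| j IH]; [now rewrite !sum_O |].
  rewrite !sum_n_succ_R, IH; real_eq; ring.
Qed.

Lemma legendre_bonnet (m : nat) (u : R) :
  legendre (S (S m)) u
  = ((2 * INR m + 3) * (u * legendre (S m) u) - (INR m + 1) * legendre m u) / (INR m + 2).
Proof.
  pose proof (pos_INR m).
  rewrite <- (legendre_sum_n (S m) (S m) u), <- sum_n_shift by lia.
  rewrite <- (legendre_sum_n m (S (S m)) u), <- (legendre_sum_n (S (S m)) (S (S m)) u) by lia.
  transitivity ((2 * INR m + 3) / (INR m + 2) *
      sum_n (fun k => match k with O => 0 | S k' => legendre_coef (S m) k' end * u ^ k) (S (S m))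
    + (- (INR m + 1) / (INR m + 2)) * sum_n (fun k => legendre_coef m k * u ^ k) (S (S m))).
  - rewrite <- sum_n_lin; apply sum_n_ext; intros k.
    change (legendre_coef (S (S m)) k) with
      (((2 * INR (S m) + 1) * match k with O => 0 | S k' => legendre_coef (S m) k' end
        - INR (S m) * legendre_coef m k) / (INR (S m) + 1)).
    rewrite S_INR; real_eq; field; lra.
  - field; lra.
Qed.

Lemma continuous_legendre (n : nat) (u : R) : continuous (legendre n) u.
Proof.
  unfold legendre; generalize (legendre_coef n) as a; intros a.
  induction n as [| n IH].
  - apply (continuous_ext (fun x => a 0%nat)); [intros; rewrite sum_O; simpl; ring |].
    apply continuous_const.
  - apply (continuous_ext (fun x => plus (sum_n (fun k => a k * x ^ k) n) (a (S n) * x ^ S n))).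
    { intros x; symmetry; apply sum_n_succ_R. }
    apply (continuous_plus (V := R_NormedModule)); [exact IH |].
    apply continuous_of_derivable; auto_derive; trivial.
Qed.

Definition legendre_moment (n p : nat) : R :=
  RInt (fun u => legendre n u * u ^ p) (-1) 1.

Lemma is_RInt_legendre_moment (n p : nat) :
  is_RInt (fun u => legendre n u * u ^ p) (-1) 1 (legendre_moment n p).
Proof.
  apply (RInt_correct (V := R_CompleteNormedModule)), ex_RInt_of_continuous.
  intros u; apply (continuous_mult (K := R_AbsRing)); [apply continuous_legendre |].
  apply continuous_of_derivable; auto_derive; trivial.
Qed.

Lemma legendre_moment_bonnet (m p : nat) :
  legendre_moment (S (S m)) p
  = ((2 * INR m + 3) * legendre_moment (S m) (S p) - (INR m + 1) * legendre_moment m p)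
    / (INR m + 2).
Proof.
  pose proof (pos_INR m).
  apply is_RInt_unique.
  replace (((2 * INR m + 3) * legendre_moment (S m) (S p) - (INR m + 1) * legendre_moment m p)
    / (INR m + 2)) with
    (plus (scal ((2 * INR m + 3) / (INR m + 2)) (legendre_moment (S m) (S p)))
          (scal (- (INR m + 1) / (INR m + 2)) (legendre_moment m p))).
  2: { unfold plus, scal; simpl; unfold mult; simpl; field; lra. }
  eapply is_RInt_ext;
    [| apply (is_RInt_plus (V := R_NormedModule)); apply (is_RInt_scal (V := R_NormedModule));
       apply is_RInt_legendre_moment].
  intros u _; rewrite legendre_bonnet.
  unfold plus, scal; simpl; unfold mult; simpl; real_eq; field; lra.
Qed.

Lemma legendre_moment_0 (p : nat) :
  legendre_moment 0 p = (1 - (-1) ^ S p) / (INR p + 1).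
Proof.
  pose proof (pos_INR p).
  apply is_RInt_unique.
  replace ((1 - (-1) ^ S p) / (INR p + 1))
    with (minus (1 ^ S p / (INR p + 1)) ((-1) ^ S p / (INR p + 1))).
  2: { unfold minus, plus, opp; simpl; rewrite pow1; field; lra. }
  apply (is_RInt_derive (V := R_CompleteNormedModule) (fun u => u ^ S p / (INR p + 1))).
  - intros u _; unfold legendre; rewrite sum_O; auto_derive; [trivial |].
    change (match p with O => 1 | S _ => INR p + 1 end) with (INR (S p)).
    rewrite S_INR; simpl; real_eq; field; lra.
  - intros u _; unfold legendre; apply continuous_of_derivable.
    apply (ex_derive_ext (fun u => 1 * u ^ p)).
    + intros t; rewrite sum_O; simpl; ring.
    + auto_derive; trivial.
Qed.

Lemma legendre_moment_1 (p : nat) : legendre_moment 1 p = legendre_moment 0 (S p).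
Proof.
  unfold legendre_moment; apply RInt_ext; intros u _.
  unfold legendre; rewrite sum_n_succ_R, !sum_O; simpl; real_eq; ring.
Qed.

(** The moment of [u ^ p] against the Legendre polynomial of degree [n] is nonzero only for
    [p = n + 2 m]; written with [half_fact], its value divided by [p!] is the coefficient in
    the Bessel series, up to elementary factors. *)
Definition legendre_moment_value (n m : nat) : R :=
  INR (fact (n + 2 * m)) / (2 ^ (n + 2 * m) * INR (fact m) * half_fact (n + m + 1)).

Lemma pow_minus_one_even (m : nat) : (-1) ^ (2 * m) = 1.
Proof. rewrite pow_mult; replace ((-1) ^ 2) with 1 by ring; apply pow1. Qed.

Lemma legendre_moment_value_0 (m : nat) :
  legendre_moment_value 0 m = 2 / (INR (2 * m) + 1).
Proof.
  unfold legendre_moment_value.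
  assert (E : INR (fact (2 * m)) = 2 ^ (2 * m) * INR (fact m) * half_fact m).
  { induction m as [| m IH]; [simpl; ring |].
    replace (2 * S m)%nat with (S (S (2 * m))) by lia.
    rewrite !fact_simpl, !mult_INR, IH, !S_INR, mult_INR; simpl; field. }
  replace (0 + 2 * m)%nat with (2 * m)%nat by lia.
  replace (0 + m + 1)%nat with (S m) by lia.
  rewrite E, mult_INR; cbn [half_fact].
  pose proof (half_fact_pos m); pose proof (pos_INR m); pose proof (INR_fact_lt_0 m).
  assert (0 < 2 ^ (2 * m)) by (apply pow_lt; lra).
  simpl (INR 2); field; repeat split; lra.
Qed.

(** Both claims propagate together through Bonnet's recurrence, which expresses a moment of
    degree [n + 2] by moments of degrees [n + 1] and [n]. *)
Lemma legendre_moment_spec (n : nat) :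
  (forall m, legendre_moment n (n + 2 * m) = legendre_moment_value n m) /\
  (forall p, (forall m, p <> (n + 2 * m)%nat) -> legendre_moment n p = 0).
Proof.
  assert (Odd0 : forall p, (forall m, p <> (2 * m)%nat) -> legendre_moment 0 p = 0).
  { intros p Hp; rewrite legendre_moment_0.
    destruct (Nat.Even_or_Odd p) as [[m E] | [m E]]; [now elim (Hp m) |].
    replace (S p) with (2 * S m)%nat by lia.
    rewrite pow_minus_one_even; unfold Rdiv; ring. }
  assert (Even0 : forall m, legendre_moment 0 (2 * m) = 2 / (INR (2 * m) + 1)).
  { intros m; rewrite legendre_moment_0, <- tech_pow_Rmult, pow_minus_one_even.
    f_equal; ring. }
  induction n as [n IH] using lt_wf_ind.
  destruct n as [| [| n]].
  - split; [| exact Odd0].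
    intros m; rewrite legendre_moment_value_0; apply Even0.
  - split.
    + intros m; rewrite legendre_moment_1.
      replace (S (1 + 2 * m)) with (2 * S m)%nat by lia.
      rewrite Even0, <- legendre_moment_value_0; unfold legendre_moment_value.
      replace (0 + 2 * S m)%nat with (S (1 + 2 * m)) by lia.
      replace (0 + S m + 1)%nat with (1 + m + 1)%nat by lia.
      rewrite !fact_simpl, !mult_INR, <- tech_pow_Rmult, !S_INR, ?plus_INR, ?mult_INR.
      pose proof (half_fact_pos (1 + m + 1)); pose proof (pos_INR m); pose proof (INR_fact_lt_0 m).
      assert (0 < 2 ^ (1 + 2 * m)) by (apply pow_lt; lra).
      simpl INR; field; repeat split; lra.
    + intros p Hp; rewrite legendre_moment_1; apply Odd0.
      intros m E; destruct m as [| m]; [lia |]; apply (Hp m); lia.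
  - destruct (IH n) as [V0 Z0]; [lia |]; destruct (IH (S n)) as [V1 Z1]; [lia |].
    pose proof (pos_INR n).
    split.
    + intros m; rewrite legendre_moment_bonnet.
      replace (S (S (S n) + 2 * m)) with (S n + 2 * S m)%nat by lia.
      replace (S (S n) + 2 * m)%nat with (n + 2 * S m)%nat by lia.
      rewrite V0, V1; unfold legendre_moment_value.
      replace (S n + 2 * S m)%nat with (S (n + 2 * S m)) by lia.
      replace (S (S n) + 2 * m)%nat with (n + 2 * S m)%nat by lia.
      replace (S n + S m + 1)%nat with (S (n + S m + 1)) by lia.
      replace (S (S n) + m + 1)%nat with (S (n + S m + 1)) by lia.
      rewrite !fact_simpl, !mult_INR; cbn [half_fact]; rewrite <- tech_pow_Rmult.
      rewrite !S_INR, !plus_INR, !mult_INR, !S_INR.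
      pose proof (half_fact_pos (n + S m + 1)); pose proof (pos_INR m); pose proof (INR_fact_lt_0 m).
      assert (0 < 2 ^ (n + 2 * S m)) by (apply pow_lt; lra).
      simpl (INR 0); field; repeat split; lra.
    + intros p Hp; rewrite legendre_moment_bonnet.
      destruct (Nat.eq_dec p n) as [-> | Hne].
      (* Here both terms of the recurrence are nonzero and cancel. *)
      * specialize (V0 0%nat); specialize (V1 0%nat).
        replace (n + 2 * 0)%nat with n in V0 by lia.
        replace (S n + 2 * 0)%nat with (S n) in V1 by lia.
        rewrite V0, V1; unfold legendre_moment_value.
        replace (S n + 2 * 0)%nat with (S n) by lia.
        replace (n + 2 * 0)%nat with n by lia.
        replace (S n + 0 + 1)%nat with (S (n + 1)) by lia.
        replace (n + 0 + 1)%nat with (n + 1)%nat by lia.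
        rewrite fact_simpl, mult_INR; cbn [half_fact]; rewrite <- tech_pow_Rmult.
        rewrite !S_INR, !plus_INR.
        pose proof (half_fact_pos (n + 1)); pose proof (INR_fact_lt_0 n).
        assert (0 < 2 ^ n) by (apply pow_lt; lra).
        simpl INR; field; repeat split; lra.
      * rewrite Z0, Z1; [unfold Rdiv; ring | |].
        -- intros [| m] E; [lia | apply (Hp m); lia].
        -- intros [| m] E; [lia | apply (Hp m); lia].
Qed.

(** * The exponential series and termwise integration *)

Lemma CV_radius_infinite (a : nat -> R) :
  (forall r, exists M, forall n, Rabs (a n * r ^ n) <= M) -> CV_radius a = p_infty.
Proof.
  intros H; destruct (CV_radius_bounded a) as [U _].
  destruct (CV_radius a) as [r | |]; [| reflexivity |].
  - pose proof (U (r + 1) (H (r + 1))) as L; simpl in L; lra.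
  - elim (U 0 (H 0)).
Qed.

Lemma ex_series_Rabs_coef (a : nat -> R) :
  CV_radius a = p_infty -> ex_series (fun p => Rabs (a p)).
Proof.
  intros H.
  assert (D : CV_disk a 1) by (apply CV_disk_inside; rewrite H; exact I).
  apply (ex_series_ext (fun p => Rabs (a p * 1 ^ p))); [| exact D].
  intros p; rewrite pow1, Rmult_1_r; reflexivity.
Qed.

Lemma exp_coef_bound (y : R) (p : nat) : 0 <= y -> y ^ p / INR (fact p) <= exp y.
Proof.
  intros Hy; eapply Rle_trans; [| exact (exp_ge_taylor y p Hy)].
  assert (T : forall k, 0 <= y ^ k / INR (fact k)).
  { intros k; apply Rdiv_le_0_compat; [apply pow_le, Hy | apply INR_fact_lt_0]. }
  destruct p as [| p]; [simpl; lra |].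
  rewrite tech5; pose proof (cond_pos_sum (fun k => y ^ k / INR (fact k)) p T); lra.
Qed.

Definition exp_coef_re (w : C) (p : nat) : R := Re (w ^ p)%C / INR (fact p).
Definition exp_coef_im (w : C) (p : nat) : R := Im (w ^ p)%C / INR (fact p).

(** Covers the real and the imaginary part of the exponential series at once; the powers of
    [r] are absorbed in [exp (Cmod w * Rabs r)]. *)
Lemma CV_radius_exp_like (w : C) (a : nat -> R) :
  (forall p, Rabs (a p) <= Cmod w ^ p / INR (fact p)) -> CV_radius a = p_infty.
Proof.
  intros H; apply CV_radius_infinite; intros r.
  exists (exp (Cmod w * Rabs r)); intros p.
  eapply Rle_trans; [| apply (exp_coef_bound _ p)].
  - rewrite Rabs_mult, <- RPow_abs, Rpow_mult_distr.
    replace (Cmod w ^ p * Rabs r ^ p / INR (fact p))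
      with (Cmod w ^ p / INR (fact p) * Rabs r ^ p) by (unfold Rdiv; ring).
    apply Rmult_le_compat_r; [apply pow_le, Rabs_pos | apply H].
  - apply Rmult_le_pos; [apply Cmod_ge_0 | apply Rabs_pos].
Qed.

Lemma Rabs_Re_le_Cmod (z : C) : Rabs (Re z) <= Cmod z.
Proof. pose proof (Rmax_Cmod z); pose proof (Rmax_l (Rabs (fst z)) (Rabs (snd z))); unfold Re; lra. Qed.

Lemma Rabs_Im_le_Cmod (z : C) : Rabs (Im z) <= Cmod z.
Proof. pose proof (Rmax_Cmod z); pose proof (Rmax_r (Rabs (fst z)) (Rabs (snd z))); unfold Im; lra. Qed.

Lemma CV_radius_exp_coef_re (w : C) : CV_radius (exp_coef_re w) = p_infty.
Proof.
  apply (CV_radius_exp_like w); intros p; unfold exp_coef_re.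
  pose proof (INR_fact_lt_0 p).
  rewrite Rabs_div, (Rabs_pos_eq (INR _)) by lra.
  apply Rmult_le_compat_r; [left; apply Rinv_0_lt_compat; lra |].
  rewrite <- Cmod_pow; apply Rabs_Re_le_Cmod.
Qed.

Lemma CV_radius_exp_coef_im (w : C) : CV_radius (exp_coef_im w) = p_infty.
Proof.
  apply (CV_radius_exp_like w); intros p; unfold exp_coef_im.
  pose proof (INR_fact_lt_0 p).
  rewrite Rabs_div, (Rabs_pos_eq (INR _)) by lra.
  apply Rmult_le_compat_r; [left; apply Rinv_0_lt_compat; lra |].
  rewrite <- Cmod_pow; apply Rabs_Im_le_Cmod.
Qed.

Lemma PSeries_lin (a c : nat -> R) (al be x : R) :
  CV_radius a = p_infty -> CV_radius c = p_infty ->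
  PSeries (fun p => al * a p + be * c p) x = al * PSeries a x + be * PSeries c x.
Proof.
  intros Ha Hc.
  rewrite <- !PSeries_scal, <- PSeries_plus; [reflexivity | |];
    apply ex_pseries_scal; try (intros; apply Rmult_comm);
    apply CV_radius_inside; [rewrite Ha | rewrite Hc]; exact I.
Qed.

Lemma is_derive_exp_series_re (w : C) (u : R) :
  is_derive (PSeries (exp_coef_re w)) u
    (Re w * PSeries (exp_coef_re w) u + - Im w * PSeries (exp_coef_im w) u).
Proof.
  rewrite <- PSeries_lin by (apply CV_radius_exp_coef_re || apply CV_radius_exp_coef_im).
  rewrite <- (PSeries_ext (PS_derive (exp_coef_re w))).
  - apply is_derive_PSeries; rewrite CV_radius_exp_coef_re; exact I.
  - intros p; unfold PS_derive, exp_coef_re, exp_coef_im.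
    rewrite fact_simpl, mult_INR; simpl Cpow.
    pose proof (INR_fact_lt_0 p); pose proof (lt_0_INR (S p) (Nat.lt_0_succ p)).
    destruct w as [a c], ((a, c) ^ p)%C as [d e]; simpl Re; simpl Im; field; lra.
Qed.

Lemma is_derive_exp_series_im (w : C) (u : R) :
  is_derive (PSeries (exp_coef_im w)) u
    (Im w * PSeries (exp_coef_re w) u + Re w * PSeries (exp_coef_im w) u).
Proof.
  rewrite <- PSeries_lin by (apply CV_radius_exp_coef_re || apply CV_radius_exp_coef_im).
  rewrite <- (PSeries_ext (PS_derive (exp_coef_im w))).
  - apply is_derive_PSeries; rewrite CV_radius_exp_coef_im; exact I.
  - intros p; unfold PS_derive, exp_coef_re, exp_coef_im.
    rewrite fact_simpl, mult_INR; simpl Cpow.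
    pose proof (INR_fact_lt_0 p); pose proof (lt_0_INR (S p) (Nat.lt_0_succ p)).
    destruct w as [a c], ((a, c) ^ p)%C as [d e]; simpl Re; simpl Im; field; lra.
Qed.

(** Both sides solve [y' = w y], [y(0) = 1]: the product of the series with [exp (- w u)] has
    zero derivative.  The proof writes this out in real and imaginary parts ([X] and [Y]
    below) and solves the resulting linear system for the two series. *)
Lemma Cexp_series (w : C) (u : R) :
  Cexp (w * RtoC u)%C = (PSeries (exp_coef_re w) u, PSeries (exp_coef_im w) u).
Proof.
  set (A := PSeries (exp_coef_re w)); set (B := PSeries (exp_coef_im w)).
  set (al := Re w); set (be := Im w).
  assert (A0 : A 0 = 1).
  { unfold A; rewrite PSeries_0; unfold exp_coef_re; simpl; field. }
  assert (B0 : B 0 = 0).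
  { unfold B; rewrite PSeries_0; unfold exp_coef_im; simpl; field. }
  assert (X : exp (- (al * u)) * (A u * cos (be * u) + B u * sin (be * u)) = 1).
  { set (F := fun u => exp (- (al * u)) * (A u * cos (be * u) + B u * sin (be * u))).
    change (F u = 1).
    transitivity (F 0); [| unfold F; rewrite A0, B0, !Rmult_0_r, cos_0, Ropp_0, exp_0; ring].
    apply derivative_zero_const; intros z; unfold F.
    pose proof (is_derive_exp_series_re w z) as DA; pose proof (is_derive_exp_series_im w z) as DB.
    fold A B al be in DA, DB.
    auto_derive.
    - repeat split; eexists; eassumption.
    - replace (Derive (fun x => A x) z) with (al * A z + - be * B z)
        by (symmetry; exact (is_derive_unique _ _ _ DA)).
      replace (Derive (fun x => B x) z) with (be * A z + al * B z)
        by (symmetry; exact (is_derive_unique _ _ _ DB)).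
      real_eq; ring. }
  assert (Y : exp (- (al * u)) * (B u * cos (be * u) - A u * sin (be * u)) = 0).
  { set (F := fun u => exp (- (al * u)) * (B u * cos (be * u) - A u * sin (be * u))).
    change (F u = 0).
    transitivity (F 0); [| unfold F; rewrite A0, B0, !Rmult_0_r, sin_0; ring].
    apply derivative_zero_const; intros z; unfold F.
    pose proof (is_derive_exp_series_re w z) as DA; pose proof (is_derive_exp_series_im w z) as DB.
    fold A B al be in DA, DB.
    auto_derive.
    - repeat split; eexists; eassumption.
    - replace (Derive (fun x => A x) z) with (al * A z + - be * B z)
        by (symmetry; exact (is_derive_unique _ _ _ DA)).
      replace (Derive (fun x => B x) z) with (be * A z + al * B z)
        by (symmetry; exact (is_derive_unique _ _ _ DB)).
      real_eq; ring. }
  assert (E : exp (al * u) * exp (- (al * u)) = 1).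
  { rewrite <- exp_plus, Rplus_opp_r; apply exp_0. }
  pose proof (sin2_cos2 (be * u)) as SC; unfold Rsqr in SC.
  pose proof (exp_pos (- (al * u))) as P.
  set (e := exp (- (al * u))) in *; set (e' := exp (al * u)) in *.
  set (s := sin (be * u)) in *; set (c := cos (be * u)) in *.
  assert (Y' : B u * c - A u * s = 0).
  { apply Rmult_integral in Y; destruct Y; lra. }
  assert (X' : A u * c + B u * s = e').
  { transitivity (e' * e * (A u * c + B u * s)); [rewrite E; ring |].
    rewrite Rmult_assoc, X; ring. }
  unfold Cexp.
  replace (Re (w * RtoC u)%C) with (al * u) by (unfold al; destruct w; simpl; ring).
  replace (Im (w * RtoC u)%C) with (be * u) by (unfold be; destruct w; simpl; ring).
  fold e' s c; f_equal.
  - transitivity (A u * (s * s + c * c)); [| rewrite SC; ring].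
    replace (e' * c) with ((A u * c + B u * s) * c) by (rewrite X'; ring).
    transitivity (A u * c * c + (B u * c) * s); [ring |].
    replace (B u * c) with (A u * s) by lra; ring.
  - transitivity (B u * (s * s + c * c)); [| rewrite SC; ring].
    replace (e' * s) with ((A u * c + B u * s) * s) by (rewrite X'; ring).
    transitivity ((A u * s) * c + B u * s * s); [ring |].
    replace (A u * s) with (B u * c) by lra; ring.
Qed.

(** Termwise integration; the remainder is at most the tail of the series of
    absolute values of the coefficients, uniformly on [-1, 1]. *)
Lemma is_series_RInt_PSeries (g : R -> R) (a : nat -> R) :
  (forall u, continuous g u) -> CV_radius a = p_infty ->
  is_series (fun p => a p * RInt (fun u => g u * u ^ p) (-1) 1)
    (RInt (fun u => g u * PSeries a u) (-1) 1).
Proof.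
  intros Hg Ha.
  pose proof (ex_series_Rabs_coef a Ha) as Sa.
  set (T := fun N => Series (fun p => Rabs (a p)) - sum_n (fun p => Rabs (a p)) N).
  set (I := fun p => RInt (fun u => g u * u ^ p) (-1) 1).
  assert (HI : forall p, is_RInt (fun u => g u * u ^ p) (-1) 1 (I p)).
  { intros p; apply (RInt_correct (V := R_CompleteNormedModule)), ex_RInt_of_continuous.
    intros u; apply (continuous_mult (K := R_AbsRing)); [apply Hg |].
    apply continuous_of_derivable; auto_derive; trivial. }
  assert (HS : forall N, is_RInt (fun u => g u * sum_n (fun p => a p * u ^ p) N) (-1) 1
                 (sum_n (fun p => a p * I p) N)).
  { induction N as [| N IH].
    - rewrite sum_O.
      apply (is_RInt_ext (fun u => scal (a 0%nat) (g u * u ^ 0))).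
      + intros u _; rewrite sum_O; unfold scal; simpl; unfold mult; simpl; real_eq; ring.
      + apply (is_RInt_scal (V := R_NormedModule)), HI.
    - rewrite sum_Sn.
      apply (is_RInt_ext (fun u => plus (g u * sum_n (fun p => a p * u ^ p) N)
                                        (scal (a (S N)) (g u * u ^ S N)))).
      + intros u _; rewrite sum_n_succ_R; unfold plus, scal; simpl; unfold mult; simpl; real_eq; ring.
      + apply (is_RInt_plus (V := R_NormedModule)); [exact IH |].
        apply (is_RInt_scal (V := R_NormedModule) (fun u => g u * u ^ S N)), HI. }
  assert (HP : is_RInt (fun u => g u * PSeries a u) (-1) 1 (RInt (fun u => g u * PSeries a u) (-1) 1)).
  { apply (RInt_correct (V := R_CompleteNormedModule)), ex_RInt_of_continuous.
    intros u; apply (continuous_mult (K := R_AbsRing)); [apply Hg |].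
    apply continuity_pt_filterlim, PSeries_continuity; rewrite Ha; exact Logic.I. }
  assert (HG : is_RInt (fun u => Rabs (g u)) (-1) 1 (RInt (fun u => Rabs (g u)) (-1) 1)).
  { apply (RInt_correct (V := R_CompleteNormedModule)), ex_RInt_of_continuous.
    intros u; apply (continuous_comp g Rabs); [apply Hg | apply continuous_Rabs]. }
  assert (Tail : forall N u, -1 <= u <= 1 ->
            Rabs (PSeries a u - sum_n (fun p => a p * u ^ p) N) <= T N).
  { intros N u Hu.
    assert (Ex : ex_series (fun p => a p * u ^ p)).
    { apply (ex_series_ext (fun p => scal (pow_n u p) (a p))).
      - intros p; rewrite pow_n_pow; unfold scal; simpl; unfold mult; simpl; real_eq; ring.
      - apply (CV_radius_inside a u); rewrite Ha; exact Logic.I. }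
    unfold T, PSeries.
    rewrite (Series_incr_n (fun p => a p * u ^ p) (S N)), (Series_incr_n (fun p => Rabs (a p)) (S N))
      by (lia || assumption).
    rewrite !sum_n_Reals; simpl pred.
    match goal with |- Rabs (?x + ?y - ?x) <= ?z + ?t - ?z =>
      replace (x + y - x) with y by ring; replace (z + t - z) with t by ring end.
    assert (Exa : ex_series (fun k => Rabs (a (S N + k)%nat)))
      by (apply (ex_series_incr_n (fun p => Rabs (a p)) (S N)); exact Sa).
    assert (B : forall k, Rabs (a (S N + k)%nat * u ^ (S N + k)) <= Rabs (a (S N + k)%nat)).
    { intros k; rewrite Rabs_mult, <- RPow_abs.
      assert (Rabs u ^ (S N + k) <= 1).
      { rewrite <- (pow1 (S N + k)); apply pow_incr; split; [apply Rabs_pos | apply Rabs_le; lra]. }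
      pose proof (Rabs_pos (a (S N + k)%nat)); nra. }
    eapply Rle_trans; [apply Series_Rabs | apply Series_le; [| exact Exa]].
    - apply (ex_series_le (V := R_CompleteNormedModule)) with (2 := Exa).
      intros k; unfold norm; simpl; unfold abs; simpl; rewrite Rabs_Rabsolu; apply B.
    - intros k; split; [apply Rabs_pos | apply B]. }
  assert (TL : is_lim_seq (fun N => T N * RInt (fun u => Rabs (g u)) (-1) 1) 0).
  { replace (Finite 0) with (Rbar_mult (Series (fun p => Rabs (a p)) - Series (fun p => Rabs (a p)))
      (RInt (fun u => Rabs (g u)) (-1) 1)) by (simpl; f_equal; ring).
    apply is_lim_seq_scal_r.
    apply is_lim_seq_minus'; [apply is_lim_seq_const | apply (Series_correct _ Sa)]. }
  assert (L : is_lim_seq (sum_n (fun p => a p * I p)) (RInt (fun u => g u * PSeries a u) (-1) 1)).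
  { apply is_lim_seq_spec; intros eps.
    apply is_lim_seq_spec in TL; destruct (TL eps) as [N0 HN]; exists N0; intros N HNN.
    specialize (HN N HNN); rewrite Rminus_0_r in HN.
    eapply Rle_lt_trans; [| eapply Rle_lt_trans; [apply Rle_abs | exact HN]].
    rewrite Rabs_minus_sym.
    apply (norm_RInt_le (V := R_NormedModule)
      (fun u => minus (g u * PSeries a u) (g u * sum_n (fun p => a p * u ^ p) N))
      (fun u => scal (T N) (Rabs (g u))) (-1) 1); [lra | | |].
    - intros u Hu; unfold minus, plus, opp, norm, scal; simpl; unfold abs, mult; simpl.
      replace (g u * PSeries a u + - (g u * sum_n (fun p => a p * u ^ p) N))
        with (g u * (PSeries a u - sum_n (fun p => a p * u ^ p) N)) by ring.
      rewrite Rabs_mult, Rmult_comm.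
      apply Rmult_le_compat_r; [apply Rabs_pos | apply Tail, Hu].
    - apply (is_RInt_minus (V := R_NormedModule)); [exact HP | apply HS].
    - apply (is_RInt_scal (V := R_NormedModule)), HG. }
  exact L.
Qed.

(** * Spherical Bessel functions as Legendre-Fourier integrals *)

Definition is_CSeries (a : nat -> C) (l : C) : Prop :=
  is_series (fun m => Re (a m)) (Re l) /\ is_series (fun m => Im (a m)) (Im l).

Lemma is_CSeries_unique (a : nat -> C) (l : C) : is_CSeries a l -> CSeries a = l.
Proof.
  intros [H1 H2]; unfold CSeries.
  rewrite (is_series_unique _ _ H1), (is_series_unique _ _ H2).
  destruct l; reflexivity.
Qed.

Lemma is_series_lin (a c : nat -> R) (la lc al be : R) :
  is_series a la -> is_series c lc ->
  is_series (fun m => al * a m + be * c m) (al * la + be * lc).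
Proof.
  intros Ha Hc.
  apply (is_series_plus (V := R_NormedModule) (fun m => al * a m) (fun m => be * c m)).
  - apply (is_series_scal (V := R_NormedModule) al a la Ha).
  - apply (is_series_scal (V := R_NormedModule) be c lc Hc).
Qed.

Lemma is_CSeries_scal (c : C) (a : nat -> C) (l : C) :
  is_CSeries a l -> is_CSeries (fun m => (c * a m)%C) (c * l)%C.
Proof.
  intros [H1 H2]; split.
  - replace (Re (c * l)%C) with (Re c * Re l + - Im c * Im l) by (destruct c, l; simpl; ring).
    eapply is_series_ext; [| exact (is_series_lin _ _ _ _ (Re c) (- Im c) H1 H2)].
    intros m; destruct c, (a m); simpl; real_eq; ring.
  - replace (Im (c * l)%C) with (Im c * Re l + Re c * Im l) by (destruct c, l; simpl; ring).
    eapply is_series_ext; [| exact (is_series_lin _ _ _ _ (Im c) (Re c) H1 H2)].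
    intros m; destruct c, (a m); simpl; real_eq; ring.
Qed.

Lemma is_CSeries_ext (a c : nat -> C) (l : C) :
  (forall m, a m = c m) -> is_CSeries a l -> is_CSeries c l.
Proof.
  intros E [H1 H2]; split.
  - apply (is_series_ext (fun m => Re (a m))); [intros m; now rewrite E | exact H1].
  - apply (is_series_ext (fun m => Im (a m))); [intros m; now rewrite E | exact H2].
Qed.

Lemma CSeries_scal_R (r : R) (a : nat -> C) :
  CSeries (fun m => RtoC r * a m)%C = (RtoC r * CSeries a)%C.
Proof.
  unfold CSeries.
  rewrite (Series_ext _ (fun m => r * Re (a m))) by (intros m; apply re_scal_l).
  rewrite (Series_ext (fun m => Im (RtoC r * a m)%C) (fun m => r * Im (a m)))
    by (intros m; apply im_scal_l).
  rewrite !Series_scal_l; unfold Cmult; simpl; f_equal; ring.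
Qed.

(** Dropping the zero terms of a series supported on [n, n + 2, n + 4, ...]. *)
Lemma is_series_step2 (n : nat) (a : nat -> R) (l : R) :
  (forall p, (forall m, p <> (n + 2 * m)%nat) -> a p = 0) ->
  is_series a l -> is_series (fun m => a (n + 2 * m)%nat) l.
Proof.
  intros Z H.
  assert (E : forall m, sum_n (fun m => a (n + 2 * m)%nat) m = sum_n a (n + 2 * m)).
  { induction m as [| m IH].
    - rewrite sum_O; replace (n + 2 * 0)%nat with n by lia.
      assert (Zn : forall j, (j < n)%nat -> sum_n a j = 0).
      { induction j as [| j IH]; intros Hj; [rewrite sum_O | rewrite sum_n_succ_R, IH by lia];
          rewrite Z by lia; [reflexivity | real_eq; ring]. }
      destruct n as [| n]; [rewrite sum_O; reflexivity |].
      rewrite sum_n_succ_R, Zn by lia; real_eq; ring.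
    - replace (n + 2 * S m)%nat with (S (S (n + 2 * m))) by lia.
      rewrite !sum_n_succ_R, IH, (Z (S (n + 2 * m))) by lia.
      replace (n + 2 * S m)%nat with (S (S (n + 2 * m))) by lia; real_eq; ring. }
  apply (is_lim_seq_ext (fun m => sum_n a (n + 2 * m)) _ l).
  - intros m; symmetry; apply E.
  - apply (is_lim_seq_subseq (sum_n a) l (fun m => (n + 2 * m)%nat)); [| exact H].
    apply eventually_subseq; intros m; lia.
Qed.

Lemma is_RInt_C (u : R -> C) (a b : R) (l : C) :
  is_RInt (fun t => Re (u t)) a b (Re l) -> is_RInt (fun t => Im (u t)) a b (Im l) ->
  is_RInt (V := C_R_NormedModule) u a b l.
Proof.
  intros H1 H2; destruct l as [l1 l2].
  exact (is_RInt_fct_extend_pair (U := R_NormedModule) (V := R_NormedModule) u a b l1 l2 H1 H2).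
Qed.

Lemma is_RInt_C_Re (u : R -> C) (a b : R) (l : C) :
  is_RInt (V := C_R_NormedModule) u a b l -> is_RInt (fun t => Re (u t)) a b (Re l).
Proof. exact (is_RInt_fct_extend_fst (U := R_NormedModule) (V := R_NormedModule) u a b l). Qed.

Lemma is_RInt_C_Im (u : R -> C) (a b : R) (l : C) :
  is_RInt (V := C_R_NormedModule) u a b l -> is_RInt (fun t => Im (u t)) a b (Im l).
Proof. exact (is_RInt_fct_extend_snd (U := R_NormedModule) (V := R_NormedModule) u a b l). Qed.

Lemma is_RInt_Cmult (c : C) (u : R -> C) (a b : R) (l : C) :
  is_RInt (V := C_R_NormedModule) u a b l ->
  is_RInt (V := C_R_NormedModule) (fun t => c * u t)%C a b (c * l)%C.
Proof.
  intros H; pose proof (is_RInt_C_Re _ _ _ _ H) as H1; pose proof (is_RInt_C_Im _ _ _ _ H) as H2.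
  apply is_RInt_C.
  - replace (Re (c * l)%C) with (plus (scal (Re c) (Re l)) (scal (- Im c) (Im l)))
      by (destruct c, l; unfold plus, scal; simpl; unfold mult; simpl; ring).
    eapply is_RInt_ext;
      [| exact (is_RInt_plus (V := R_NormedModule) _ _ _ _ _ _
                  (is_RInt_scal (V := R_NormedModule) _ _ _ (Re c) _ H1)
                  (is_RInt_scal (V := R_NormedModule) _ _ _ (- Im c) _ H2))].
    intros t _; destruct c, (u t); unfold plus, scal; simpl; unfold mult; simpl; real_eq; ring.
  - replace (Im (c * l)%C) with (plus (scal (Im c) (Re l)) (scal (Re c) (Im l)))
      by (destruct c, l; unfold plus, scal; simpl; unfold mult; simpl; ring).
    eapply is_RInt_ext;
      [| exact (is_RInt_plus (V := R_NormedModule) _ _ _ _ _ _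
                  (is_RInt_scal (V := R_NormedModule) _ _ _ (Im c) _ H1)
                  (is_RInt_scal (V := R_NormedModule) _ _ _ (Re c) _ H2))].
    intros t _; destruct c, (u t); unfold plus, scal; simpl; unfold mult; simpl; real_eq; ring.
Qed.

Lemma is_RInt_Cplus (u v : R -> C) (a b : R) (l m : C) :
  is_RInt (V := C_R_NormedModule) u a b l -> is_RInt (V := C_R_NormedModule) v a b m ->
  is_RInt (V := C_R_NormedModule) (fun t => u t + v t)%C a b (l + m)%C.
Proof. exact (is_RInt_plus (V := C_R_NormedModule) u v a b l m). Qed.

Definition fourier_legendre (n : nat) (w : C) : C :=
  CInt (fun u => RtoC (legendre n u) * Cexp (w * RtoC u))%C (-1) 1.

Lemma continuous_PSeries_everywhere (a : nat -> R) (u : R) :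
  CV_radius a = p_infty -> continuous (PSeries a) u.
Proof.
  intros H; apply continuity_pt_filterlim, PSeries_continuity; rewrite H; exact I.
Qed.

Lemma is_RInt_fourier_legendre_parts (n : nat) (w : C) :
  is_RInt (V := C_R_NormedModule) (fun u => RtoC (legendre n u) * Cexp (w * RtoC u))%C (-1) 1
    (RInt (fun u => legendre n u * PSeries (exp_coef_re w) u) (-1) 1,
     RInt (fun u => legendre n u * PSeries (exp_coef_im w) u) (-1) 1).
Proof.
  apply is_RInt_C.
  - apply (is_RInt_ext (fun u => legendre n u * PSeries (exp_coef_re w) u)).
    + intros u _; rewrite Cexp_series; simpl; real_eq; ring.
    + apply (RInt_correct (V := R_CompleteNormedModule)), ex_RInt_of_continuous.
      intros u; apply (continuous_mult (K := R_AbsRing)); [apply continuous_legendre |].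
      apply continuous_PSeries_everywhere, CV_radius_exp_coef_re.
  - apply (is_RInt_ext (fun u => legendre n u * PSeries (exp_coef_im w) u)).
    + intros u _; rewrite Cexp_series; simpl; real_eq; ring.
    + apply (RInt_correct (V := R_CompleteNormedModule)), ex_RInt_of_continuous.
      intros u; apply (continuous_mult (K := R_AbsRing)); [apply continuous_legendre |].
      apply continuous_PSeries_everywhere, CV_radius_exp_coef_im.
Qed.

Lemma fourier_legendre_eq (n : nat) (w : C) :
  fourier_legendre n w =
    (RInt (fun u => legendre n u * PSeries (exp_coef_re w) u) (-1) 1,
     RInt (fun u => legendre n u * PSeries (exp_coef_im w) u) (-1) 1).
Proof.
  apply (is_RInt_unique (V := C_R_CompleteNormedModule)), is_RInt_fourier_legendre_parts.
Qed.

Lemma is_RInt_fourier_legendre (n : nat) (w : C) :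
  is_RInt (V := C_R_NormedModule) (fun u => RtoC (legendre n u) * Cexp (w * RtoC u))%C (-1) 1
    (fourier_legendre n w).
Proof. rewrite fourier_legendre_eq; apply is_RInt_fourier_legendre_parts. Qed.

Lemma RtoC_neq_0 (r : R) : r <> 0 -> RtoC r <> RtoC 0.
Proof. intros H E; apply H, RtoC_inj, E. Qed.

(** Integrating the exponential series termwise leaves the moments of the Legendre
    polynomial, of which only those of order [n + 2 m] survive. *)
Lemma fourier_legendre_series (n : nat) (w : C) :
  is_CSeries (fun m => (w / 2) ^ n *
      ((w * w / 4) ^ m / RtoC (INR (fact m) * half_fact (n + m + 1))))%C
    (fourier_legendre n w).
Proof.
  destruct (legendre_moment_spec n) as [V Z].
  assert (T : forall m, ((w / 2) ^ n * ((w * w / 4) ^ m / RtoC (INR (fact m) * half_fact (n + m + 1))))%C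
     = (w ^ (n + 2 * m) * RtoC (legendre_moment n (n + 2 * m) / INR (fact (n + 2 * m))))%C).
  { intros m; rewrite V; unfold legendre_moment_value.
    rewrite Cpow_add_r, Cpow_mult_r, pow_add, pow_mult.
    replace (w * w / 4)%C with (w ^ 2 * / 4)%C by (simpl; field).
    unfold Cdiv; rewrite !Cpow_mult_l, !Cpow_inv by (apply RtoC_neq_0; lra).
    pose proof (INR_fact_lt_0 (n + 2 * m)); pose proof (INR_fact_lt_0 m).
    pose proof (half_fact_pos (n + m + 1)).
    assert (0 < 2 ^ n) by (apply pow_lt; lra).
    replace (2 ^ 2) with 4 by ring.
    assert (0 < 4 ^ m) by (apply pow_lt; lra).
    rewrite <- !RtoC_pow, <- !RtoC_inv by nra.
    transitivity (w ^ n * (w ^ 2) ^ m * RtoC (/ 2 ^ n * / 4 ^ m * / (INR (fact m) * half_fact (n + m + 1))))%C.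
    { rewrite !RtoC_mult; ring. }
    f_equal; f_equal; field; repeat split; lra. }
  rewrite fourier_legendre_eq; split.
  - apply (is_series_ext (fun m => exp_coef_re w (n + 2 * m) * legendre_moment n (n + 2 * m))).
    { intros m; rewrite T; unfold exp_coef_re.
      rewrite re_scal_r.
      pose proof (INR_fact_lt_0 (n + 2 * m)); real_eq; field; lra. }
    apply (is_series_step2 n (fun p => exp_coef_re w p * legendre_moment n p)).
    + intros p Hp; rewrite Z by exact Hp; ring.
    + apply is_series_RInt_PSeries; [apply continuous_legendre | apply CV_radius_exp_coef_re].
  - apply (is_series_ext (fun m => exp_coef_im w (n + 2 * m) * legendre_moment n (n + 2 * m))).
    { intros m; rewrite T; unfold exp_coef_im.
      rewrite im_scal_r.
      pose proof (INR_fact_lt_0 (n + 2 * m)); real_eq; field; lra. }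
    apply (is_series_step2 n (fun p => exp_coef_im w p * legendre_moment n p)).
    + intros p Hp; rewrite Z by exact Hp; ring.
    + apply is_series_RInt_PSeries; [apply continuous_legendre | apply CV_radius_exp_coef_im].
Qed.

Lemma Cexp_plus (z w : C) : Cexp (z + w)%C = (Cexp z * Cexp w)%C.
Proof.
  destruct z as [a c], w as [d e]; unfold Cexp, Cplus, Cmult; simpl.
  rewrite exp_plus, cos_plus, sin_plus; f_equal; ring.
Qed.

Lemma Cexp_RtoC (r : R) : Cexp (RtoC r) = RtoC (exp r).
Proof. unfold Cexp, RtoC; simpl; rewrite cos_0, sin_0; f_equal; ring. Qed.

Lemma Cexp_INR_mult (n : nat) (z : C) : Cexp (RtoC (INR n) * z)%C = (Cexp z ^ n)%C.
Proof.
  induction n as [| n IH].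
  - simpl; rewrite Cmult_0_l, Cexp_RtoC, exp_0; reflexivity.
  - rewrite S_INR, RtoC_plus, Cmult_plus_distr_r, Cmult_1_l, Cexp_plus, IH, Cpow_S; ring.
Qed.

(** [Carg] is an argument, so [(ln |z|, Carg z)] is a logarithm of [z]. *)
Lemma Cexp_log (z : C) : z <> RtoC 0 -> Cexp (ln (Cmod z), Carg z) = z.
Proof.
  intros Hz.
  pose proof (proj1 (Cmod_gt_0 z) Hz) as Hr.
  pose proof (Rabs_Re_le_Cmod z) as HR.
  unfold Cexp; simpl; rewrite exp_ln by exact Hr.
  assert (B : -1 <= Re z / Cmod z <= 1).
  { apply Rabs_le_between in HR; split; [apply Rle_div_r | apply Rle_div_l]; lra. }
  assert (S : sin (acos (Re z / Cmod z)) = Rabs (Im z) / Cmod z).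
  { rewrite sin_acos by exact B.
    replace (1 - (Re z / Cmod z)²) with ((Rabs (Im z) / Cmod z)²).
    - apply sqrt_Rsqr, Rdiv_le_0_compat; [apply Rabs_pos | exact Hr].
    - rewrite !Rsqr_div', <- Rsqr_abs.
      assert (E : Cmod z * Cmod z = Re z * Re z + Im z * Im z).
      { unfold Cmod; rewrite sqrt_sqrt by (simpl; nra); unfold Re, Im; simpl; ring. }
      unfold Rsqr; rewrite E; field; rewrite <- E; nra. }
  destruct z as [x y]; simpl Re in *; simpl Im in *; unfold Carg; simpl Re; simpl Im.
  destruct (Rle_dec 0 y) as [Hy | Hy].
  - rewrite cos_acos, S, Rabs_pos_eq by assumption; f_equal; field; lra.
  - rewrite cos_neg, sin_neg, cos_acos, S, Rabs_left by lra; f_equal; field; lra.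
Qed.

Lemma Cmod_scal_pos (c : R) (z : C) : 0 < c -> Cmod (RtoC c * z)%C = c * Cmod z.
Proof. intros Hc; rewrite Cmod_mult, Cmod_R, Rabs_pos_eq by lra; reflexivity. Qed.

Lemma Carg_scal_pos (c : R) (z : C) : 0 < c -> z <> RtoC 0 -> Carg (RtoC c * z)%C = Carg z.
Proof.
  intros Hc Hz; pose proof (proj1 (Cmod_gt_0 z) Hz) as Hr.
  unfold Carg; rewrite Cmod_scal_pos, re_scal_l, im_scal_l by exact Hc.
  replace (c * Re z / (c * Cmod z)) with (Re z / Cmod z) by (field; lra).
  destruct (Rle_dec 0 (c * Im z)), (Rle_dec 0 (Im z)); try reflexivity; nra.
Qed.

Lemma Cpower_scal_pos (c : R) (z : C) (a : R) : 0 < c -> z <> RtoC 0 ->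
  Cpower (RtoC c * z)%C a
  = (RtoC (exp (a * ln c)) * Cexp (RtoC a * (ln (Cmod z), Carg z)))%C.
Proof.
  intros Hc Hz; pose proof (proj1 (Cmod_gt_0 z) Hz) as Hr.
  unfold Cpower; rewrite Carg_scal_pos, Cmod_scal_pos, ln_mult by assumption.
  rewrite <- Cexp_RtoC, <- Cexp_plus; f_equal.
  unfold Cmult, Cplus, RtoC; simpl; f_equal; ring.
Qed.

(** With the same logarithm in both powers, the exponents of [z] add up to the integer [n], so
    that no branch is left. *)
Lemma sphj_prefactor (n : nat) (z : C) : z <> RtoC 0 ->
  (Cpower (2 * z / RtoC PI) (- / 2) * Cpower (z / 2) (INR n + / 2))%C
  = (RtoC (sqrt PI / 2) * (z / 2) ^ n)%C.
Proof.
  intros Hz; pose proof PI_RGT_0 as Hpi.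
  replace (2 * z / RtoC PI)%C with (RtoC (2 / PI) * z)%C
    by (rewrite RtoC_div by lra; field; apply RtoC_neq_0; lra).
  replace (z / 2)%C with (RtoC (/ 2) * z)%C by (rewrite RtoC_inv by lra; field).
  assert (0 < 2 / PI) by (apply Rdiv_lt_0_compat; lra).
  rewrite !Cpower_scal_pos by (assumption || lra).
  set (Z := (ln (Cmod z), Carg z) : C).
  assert (EZ : Cexp Z = z) by (apply Cexp_log, Hz).
  replace (RtoC (exp (- / 2 * ln (2 / PI))) * Cexp (RtoC (- / 2) * Z) *
           (RtoC (exp ((INR n + / 2) * ln (/ 2))) * Cexp (RtoC (INR n + / 2) * Z)))%C
    with (RtoC (exp (- / 2 * ln (2 / PI)) * exp ((INR n + / 2) * ln (/ 2)))
          * (Cexp (RtoC (- / 2) * Z) * Cexp (RtoC (INR n + / 2) * Z)))%C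
    by (rewrite RtoC_mult; ring).
  rewrite <- Cexp_plus.
  replace (RtoC (- / 2) * Z + RtoC (INR n + / 2) * Z)%C with (RtoC (INR n) * Z)%C
    by (rewrite RtoC_plus, RtoC_opp; ring).
  rewrite Cexp_INR_mult, EZ, Cpow_mult_l, <- RtoC_pow, Cmult_assoc, <- RtoC_mult.
  f_equal; f_equal.
  rewrite <- exp_plus, ln_div, ln_Rinv by lra.
  replace (- / 2 * (ln 2 - ln PI) + (INR n + / 2) * - ln 2)
    with (/ 2 * ln PI + (- ln 2 + INR n * - ln 2)) by field.
  rewrite !exp_plus, <- exp_pow, !exp_Ropp, exp_ln by lra.
  change (exp (/ 2 * ln PI)) with (Rpower PI (/ 2)).
  rewrite Rpower_sqrt by lra; unfold Rdiv; ring.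
Qed.

Lemma sphj_eq (n : nat) (z : C) : z <> RtoC 0 ->
  sphj n z = (/ 2 * (z / 2) ^ n *
    CSeries (fun m => (- (z * z / 4)) ^ m / RtoC (INR (fact m) * half_fact (n + m + 1))))%C.
Proof.
  intros Hz; unfold sphj, besselJ.
  rewrite Cmult_assoc, sphj_prefactor by exact Hz.
  pose proof (sqrt_lt_R0 PI PI_RGT_0) as Hs.
  replace (CSeries (fun m => (- (z * z / 4)) ^ m / RtoC (INR (fact m) * Gamma (INR n + / 2 + INR m + 1))))%C
    with (RtoC (/ sqrt PI) * CSeries (fun m => (- (z * z / 4)) ^ m / RtoC (INR (fact m) * half_fact (n + m + 1))))%C.
  - rewrite RtoC_div, RtoC_inv by lra; field.
    apply RtoC_neq_0; lra.
  - rewrite <- CSeries_scal_R.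
    unfold CSeries; f_equal; apply Series_ext; intros m; f_equal;
      (replace (INR n + / 2 + INR m + 1) with (INR (n + m + 1) + / 2) by (rewrite !plus_INR; simpl; ring));
      rewrite Gamma_half; pose proof (INR_fact_lt_0 m); pose proof (half_fact_pos (n + m + 1));
      rewrite !RtoC_mult, RtoC_inv by lra; field; repeat split; apply RtoC_neq_0; lra.
Qed.

(** For [s = i] and [s = - i] this is the classical formula: the integral of
    [P_n(u) exp (s z u)] over [-1, 1] equals [2 s^n j_n(z)].  Stating it for any square root of
    [-1] serves the cosine and the sine alike. *)
Lemma fourier_legendre_sphj (n : nat) (s z : C) : (s * s)%C = (- (1))%C -> z <> RtoC 0 ->
  fourier_legendre n (s * z)%C = (2 * s ^ n * sphj n z)%C.
Proof.
  intros Hs Hz; rewrite sphj_eq by exact Hz.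
  assert (Hs0 : s <> RtoC 0).
  { intros ->; rewrite Cmult_0_l in Hs; apply (f_equal Re) in Hs; simpl in Hs; lra. }
  assert (H2 : RtoC 2 <> RtoC 0) by (apply RtoC_neq_0; lra).
  set (k := (s * z / 2)%C).
  assert (Hk : (k ^ n)%C <> RtoC 0).
  { apply Cpow_nz; unfold k, Cdiv; repeat apply Cmult_neq_0; try assumption.
    intros E; apply (f_equal (fun w => w * 2)%C) in E; rewrite Cinv_l in E by exact H2.
    rewrite Cmult_0_l in E; apply (RtoC_neq_0 1); [lra | exact E]. }
  pose proof (is_CSeries_scal (/ k ^ n)%C _ _ (fourier_legendre_series n (s * z)%C)) as H.
  fold k in H.
  rewrite (is_CSeries_unique _ (/ k ^ n * fourier_legendre n (s * z))%C).
  - replace (k ^ n)%C with (s ^ n * (z / 2) ^ n)%C in *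
      by (rewrite <- Cpow_mult_l; f_equal; unfold k; field).
    field.
    split; intros E; apply Hk; rewrite E; ring.
  - eapply is_CSeries_ext; [| exact H]; intros m; cbv beta.
    replace (s * z * (s * z) / 4)%C with (- (z * z / 4))%C.
    + field; split; [| exact Hk].
      apply RtoC_neq_0; pose proof (INR_fact_lt_0 m); pose proof (half_fact_pos (n + m + 1)); nra.
    + replace (s * z * (s * z))%C with ((s * s) * (z * z))%C by ring; rewrite Hs; field.
Qed.

(** * Leibniz' rule on the triangle *)

Definition clamp (lo hi s : R) : R := Rmax lo (Rmin hi s).

Lemma clamp_bounds (lo hi s : R) : lo <= hi -> lo <= clamp lo hi s <= hi.
Proof.
  intros H; unfold clamp, Rmax, Rmin.
  destruct (Rle_dec hi s); destruct (Rle_dec lo _); lra.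
Qed.

Lemma clamp_id (lo hi s : R) : lo <= s <= hi -> clamp lo hi s = s.
Proof.
  intros H; unfold clamp; rewrite Rmin_right, Rmax_right; lra.
Qed.

Lemma continuous_Rmax {U : UniformSpace} (f g : U -> R) (x : U) :
  continuous f x -> continuous g x -> continuous (fun y => Rmax (f y) (g y)) x.
Proof.
  intros Hf Hg.
  apply (continuous_ext (fun y => scal (/ 2) (plus (plus (f y) (g y)) (Rabs (minus (f y) (g y)))))).
  - intros y; unfold scal, plus, minus, opp, Rmax; simpl; unfold mult; simpl.
    unfold plus; simpl.
    destruct (Rle_dec (f y) (g y)); [rewrite Rabs_left1 by lra | rewrite Rabs_pos_eq by lra]; lra.
  - apply (continuous_scal_r (V := R_NormedModule) (/ 2)).
    apply (continuous_plus (V := R_NormedModule)).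
    + apply (continuous_plus (V := R_NormedModule)); assumption.
    + apply (continuous_comp (fun y => minus (f y) (g y)) Rabs); [| apply continuous_Rabs].
      apply (continuous_minus (V := R_NormedModule)); assumption.
Qed.

Lemma continuous_Rmin {U : UniformSpace} (f g : U -> R) (x : U) :
  continuous f x -> continuous g x -> continuous (fun y => Rmin (f y) (g y)) x.
Proof.
  intros Hf Hg.
  apply (continuous_ext (fun y => opp (Rmax (opp (f y)) (opp (g y))))).
  - intros y; unfold opp, Rmax, Rmin; simpl.
    destruct (Rle_dec (f y) (g y)), (Rle_dec (- f y) (- g y)); lra.
  - apply (continuous_opp (V := R_NormedModule)), continuous_Rmax;
      apply (continuous_opp (V := R_NormedModule)); assumption.
Qed.

(** Functions on the triangle are extended to the whole plane by composition with this
    retraction, which keeps them continuous. *)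
Definition retract (b : R) (p : R * R) : R * R :=
  (clamp 0 b (fst p), clamp (- clamp 0 b (fst p)) (clamp 0 b (fst p)) (snd p)).

Lemma retract_triangle (b : R) (p : R * R) : 0 < b -> Defs.triangle b (retract b p).
Proof.
  intros Hb; pose proof (clamp_bounds 0 b (fst p) (Rlt_le _ _ Hb)) as H.
  split; simpl; [exact H |].
  apply Rabs_le, clamp_bounds; lra.
Qed.

Lemma retract_id (b x t : R) : 0 <= x <= b -> Rabs t <= x -> retract b (x, t) = (x, t).
Proof.
  intros Hx Ht; apply Rabs_le_between in Ht; unfold retract; simpl.
  rewrite (clamp_id 0 b x), clamp_id by lra; reflexivity.
Qed.

Lemma continuous_pair {U V W : UniformSpace} (f : U -> V) (g : U -> W) (x : U) :
  continuous f x -> continuous g x -> continuous (fun y => (f y, g y)) x.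
Proof.
  intros Hf Hg.
  apply (continuous_comp_2 f g (fun a c => (a, c)) x Hf Hg).
  apply (continuous_ext (fun p => p)); [intros [? ?]; reflexivity | apply continuous_id].
Qed.

Lemma continuous_retract (b : R) (p : R * R) : continuous (retract b) p.
Proof.
  assert (C1 : continuous (fun p : R * R => clamp 0 b (fst p)) p).
  { apply continuous_Rmax; [apply continuous_const |].
    apply continuous_Rmin; [apply continuous_const | apply continuous_fst]. }
  apply continuous_pair; [exact C1 |].
  apply continuous_Rmax; [apply (continuous_opp (V := R_NormedModule)), C1 |].
  apply continuous_Rmin; [exact C1 | apply continuous_snd].
Qed.

Lemma continuous_on_retract (b : R) (k : R * R -> R) (p : R * R) : 0 < b ->
  continuous_on (Defs.triangle b) k -> continuous (fun p => k (retract b p)) p.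
Proof.
  intros Hb Hk.
  eapply filterlim_comp; [| apply Hk, retract_triangle, Hb].
  intros P HP.
  apply (continuous_retract b p) in HP.
  unfold filtermap in *.
  revert HP; apply filter_imp; intros q Hq; apply Hq, retract_triangle, Hb.
Qed.

Lemma continuous_clamp (lo hi : R) (x : R) : continuous (clamp lo hi) x.
Proof.
  apply continuous_Rmax; [apply continuous_const |].
  apply continuous_Rmin; [apply continuous_const | apply continuous_id].
Qed.

Lemma continuous_slice (k : R -> R -> R) (s t : R) :
  continuous (fun p => k (fst p) (snd p)) (s, t) ->
  continuous (fun t => k s t) t /\ continuous (fun s => k s t) s.
Proof.
  intros H; split.
  - apply (continuous_comp (fun t => (s, t)) (fun p => k (fst p) (snd p))); [| exact H].
    apply continuous_pair; [apply continuous_const | apply continuous_id].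
  - apply (continuous_comp (fun s => (s, t)) (fun p => k (fst p) (snd p))); [| exact H].
    apply continuous_pair; [apply continuous_id | apply continuous_const].
Qed.

(** Uniform continuity of [v] near the compact segment [t = t0]. *)
Lemma continuous_RInt_param (v : R -> R -> R) (b x t0 : R) :
  (forall p, continuous (fun p => v (fst p) (snd p)) p) ->
  continuous (fun t => RInt (fun s => v s t) b x) t0.
Proof.
  intros Hv.
  assert (Ex : forall t a c, ex_RInt (fun s => v s t) a c).
  { intros t a c; apply ex_RInt_of_continuous; intros s.
    apply (continuous_slice v s t), Hv. }
  assert (Main : forall a c, a <= c -> continuous (fun t => RInt (fun s => v s t) a c) t0).
  { intros a c Hac; apply continuity_pt_filterlim.
    intros e He.
    assert (He' : 0 < e / (c - a + 1)) by (apply Rdiv_lt_0_compat; lra).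
    destruct (uniform_continuity_2d_1d v a c t0) with (eps := mkposreal _ He') as [d Hd].
    { intros s _; apply continuity_2d_pt_filterlim, Hv. }
    exists d; split; [apply cond_pos |].
    intros t [_ Ht]; unfold dist in *; simpl in *; unfold R_dist in *.
    apply Rabs_lt_between in Ht.
    apply Rle_lt_trans with (e / (c - a + 1) * (c - a)).
    - apply (norm_RInt_le (V := R_NormedModule) (fun s => minus (v s t) (v s t0))
        (fun _ => e / (c - a + 1)) a c _ _ Hac).
      + intros s Hs; pose proof (cond_pos d) as Pd; left; apply (Hd s t0 s t); try lra.
        rewrite Rminus_diag, Rabs_R0; apply cond_pos.
      + apply (is_RInt_minus (V := R_NormedModule)); apply (RInt_correct (V := R_CompleteNormedModule)), Ex.
      + replace (e / (c - a + 1) * (c - a)) with (scal (c - a) (e / (c - a + 1)))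
          by (unfold scal; simpl; unfold mult; simpl; ring).
        apply (is_RInt_const (V := R_NormedModule)).
    - apply Rmult_lt_reg_r with (c - a + 1); [lra |].
      unfold Rdiv; field_simplify; [nra | lra]. }
  destruct (Rle_dec b x) as [H | H]; [apply Main, H |].
  apply (continuous_ext (fun t => opp (RInt (fun s => v s t) x b))).
  - intros t; apply (opp_RInt_swap (V := R_CompleteNormedModule)), Ex.
  - apply (continuous_opp (V := R_NormedModule)), Main; lra.
Qed.

(** Leibniz' rule on the triangle.  The kernel is differentiable only inside it, while the
    limits of integration run along its sides.  Replacing the kernel by [k b t] plus the
    integral of [v s t] for [s] from [b] to [x], with [k] and [v] composed with the
    retraction, gives a function on the whole plane that agrees with [k] on the triangle and
    to which the usual rule applies.  The resulting [F] is differentiable at [x] in the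
    two-sided sense even for [x = b]. *)
Lemma is_derive_RInt_triangle (b : R) (k v : R -> R -> R) (g : R -> R) (x : R) :
  0 < b -> 0 < x <= b ->
  continuous_on (Defs.triangle b) (fun p => k (fst p) (snd p)) ->
  continuous_on (Defs.triangle b) (fun p => v (fst p) (snd p)) ->
  (forall x t, x < b -> Rabs t < x -> is_derive (fun y => k y t) x (v x t)) ->
  (forall t, continuous g t) ->
  exists F : R -> R,
    (forall y, 0 <= y <= b -> is_RInt (fun t => k y t * g t) (- y) y (F y)) /\
    exists I : R, is_RInt (fun t => v x t * g t) (- x) x I /\
      is_derive F x (I + k x (- x) * g (- x) + k x x * g x).
Proof.
  intros Hb Hx Hk Hv Hd Hg.
  set (kr := fun s t => k (fst (retract b (s, t))) (snd (retract b (s, t)))).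
  set (vr := fun s t => v (fst (retract b (s, t))) (snd (retract b (s, t)))).
  assert (Ck : forall p, continuous (fun p => kr (fst p) (snd p)) p).
  { intros p; apply (continuous_ext (fun p => k (fst (retract b p)) (snd (retract b p)))).
    - intros [s t]; reflexivity.
    - apply (continuous_on_retract b (fun p => k (fst p) (snd p))); assumption. }
  assert (Cv : forall p, continuous (fun p => vr (fst p) (snd p)) p).
  { intros p; apply (continuous_ext (fun p => v (fst (retract b p)) (snd (retract b p)))).
    - intros [s t]; reflexivity.
    - apply (continuous_on_retract b (fun p => v (fst p) (snd p))); assumption. }
  assert (Ev : forall s t, 0 <= s <= b -> Rabs t <= s -> vr s t = v s t).
  { intros s t Hs Ht; unfold vr; rewrite retract_id by assumption; reflexivity. }
  assert (Ek : forall s t, 0 <= s <= b -> Rabs t <= s -> kr s t = k s t).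
  { intros s t Hs Ht; unfold kr; rewrite retract_id by assumption; reflexivity. }
  set (ke := fun s t => kr b t + RInt (fun s => vr s t) b s).
  assert (Dke : forall s t, is_derive (fun s => ke s t) s (vr s t)).
  { intros s t; unfold ke.
    replace (vr s t) with (plus zero (vr s t)) by apply plus_zero_l.
    apply (is_derive_plus (V := R_NormedModule) (fun _ => kr b t));
      [apply (is_derive_const (V := R_NormedModule)) |].
    apply (is_derive_RInt (V := R_NormedModule) (fun s => vr s t) _ b).
    - apply filter_forall; intros z.
      apply (RInt_correct (V := R_CompleteNormedModule)), ex_RInt_of_continuous; intros r.
      apply (continuous_slice vr r t), Cv.
    - apply (continuous_slice vr s t), Cv. }
  assert (Ct : forall s t, continuous (fun t => ke s t) t).
  { intros s t; unfold ke; apply (continuous_plus (V := R_NormedModule)).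
    - apply (continuous_slice kr b t), Ck.
    - apply continuous_RInt_param, Cv. }
  assert (Eke : forall s t, 0 <= s <= b -> Rabs t <= s -> ke s t = k s t).
  { intros s t Hs Ht; pose proof (Rabs_pos t).
    destruct (Rle_lt_or_eq_dec s b (proj2 Hs)) as [Hsb | ->].
    2: { unfold ke; rewrite RInt_point, Ek by lra; unfold zero; simpl; ring. }
    (* On the part of the line inside the triangle [psi] has zero derivative; clamping makes it
       continuous at the ends, where the line may touch the boundary. *)
    set (psi := fun s => kr (clamp (Rabs t) b s) t - ke s t).
    destruct (MVT_gen psi s b (fun _ => 0)) as [c [_ E]].
    - intros r Hr; rewrite Rmin_left, Rmax_right in Hr by lra.
      unfold psi.
      replace 0 with (minus (v r t) (vr r t)).
      2: { rewrite Ev by lra; apply (minus_eq_zero (G := R_AbelianGroup)). }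
      apply (is_derive_minus (V := R_NormedModule)); [| apply Dke].
      apply (is_derive_ext_loc (fun y => k y t)); [| apply Hd; lra].
      assert (Hm : 0 < Rmin (r - s) (b - r)) by (apply Rmin_glb_lt; lra).
      exists (mkposreal _ Hm); intros y Hy.
      apply Rabs_lt_between in Hy; simpl in Hy; unfold minus, plus, opp in Hy; simpl in Hy.
      pose proof (Rmin_l (r - s) (b - r)); pose proof (Rmin_r (r - s) (b - r)).
      rewrite clamp_id, Ek by lra; reflexivity.
    - intros r _; apply continuity_pt_filterlim.
      apply (continuous_minus (V := R_NormedModule)).
      + apply (continuous_comp (clamp (Rabs t) b) (fun s => kr s t)); [apply continuous_clamp |].
        apply (continuous_slice kr _ t), Ck.
      + apply continuous_of_derivable; eexists; apply Dke.
    - unfold psi in E; rewrite !clamp_id, !Ek in E by lra.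
      assert (Eb : ke b t = k b t).
      { unfold ke; rewrite RInt_point, Ek by lra; unfold zero; simpl; ring. }
      lra. }
  set (F := fun y => RInt (fun t => ke y t * g t) (- y) y).
  assert (Exk : forall y a c, ex_RInt (fun t => ke y t * g t) a c).
  { intros y a c; apply ex_RInt_of_continuous; intros t.
    apply (continuous_mult (K := R_AbsRing)); [apply Ct | apply Hg]. }
  assert (Cvg : forall p, continuous (fun p => vr (fst p) (snd p) * g (snd p)) p).
  { intros p; apply (continuous_mult (K := R_AbsRing)); [apply Cv |].
    apply (continuous_comp snd g); [apply continuous_snd | apply Hg]. }
  assert (D2 : forall s t, is_derive (fun s => ke s t * g t) s (vr s t * g t)).
  { intros s t.
    apply (is_derive_ext (fun s => scal (ke s t) (g t))); [reflexivity |].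
    apply (is_derive_scal_l (V := R_NormedModule) (fun s => ke s t)), Dke. }
  assert (C2 : forall s t, continuity_2d_pt (fun u w => Derive (fun z => ke z w * g w) u) s t).
  { intros s t; apply (continuity_2d_pt_ext (fun s t => vr s t * g t)).
    - intros u w; symmetry; apply is_derive_unique, D2.
    - apply continuity_2d_pt_filterlim, Cvg. }
  exists F; split.
  - intros y Hy; apply (is_RInt_ext (fun t => ke y t * g t)).
    + intros t Ht; rewrite Rmin_left, Rmax_right in Ht by lra.
      rewrite Eke; [reflexivity | exact Hy | apply Rabs_le; lra].
    + apply (RInt_correct (V := R_CompleteNormedModule)), Exk.
  - exists (RInt (fun t => vr x t * g t) (- x) x); split.
    + apply (is_RInt_ext (fun t => vr x t * g t)).
      * intros t Ht; rewrite Rmin_left, Rmax_right in Ht by lra.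
        rewrite Ev; [reflexivity | lra | apply Rabs_le; lra].
      * apply (RInt_correct (V := R_CompleteNormedModule)), ex_RInt_of_continuous.
        intros t; apply (continuous_slice (fun s t => vr s t * g t) x t), Cvg.
    + rewrite <- (Eke x (- x)), <- (Eke x x) by (lra || (rewrite ?Rabs_Ropp, Rabs_pos_eq; lra)).
      rewrite <- (RInt_ext (fun t => Derive (fun u => ke u t * g t) x))
        by (intros t _; apply is_derive_unique, D2).
      replace (ke x (- x) * g (- x)) with (- (ke x (- x) * g (- x)) * (- 1)) by ring.
      replace (ke x x * g x) with (ke x x * g x * 1) by ring.
      apply (is_derive_RInt_param_bound_comp (fun s t => ke s t * g t) Ropp (fun y => y) x (- 1) 1).
      * apply filter_forall; intros; apply Exk.
      * exists (mkposreal 1 Rlt_0_1); apply filter_forall; intros; apply Exk.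
      * exists (mkposreal 1 Rlt_0_1); apply filter_forall; intros; apply Exk.
      * auto_derive; [trivial | ring].
      * apply (is_derive_id (K := R_AbsRing)).
      * exists (mkposreal 1 Rlt_0_1); apply filter_forall; intros; eexists; apply D2.
      * intros; apply C2.
      * exists (mkposreal 1 Rlt_0_1); intros; apply C2.
      * exists (mkposreal 1 Rlt_0_1); intros; apply C2.
      * apply continuity_pt_filterlim, (continuous_mult (K := R_AbsRing)); [apply Ct | apply Hg].
      * apply continuity_pt_filterlim, (continuous_mult (K := R_AbsRing)); [apply Ct | apply Hg].
Qed.

(** * Complex-valued functions and derivatives relative to an interval *)

Lemma is_derive_C_Re (u : R -> C) (x : R) (l : C) :
  is_derive (V := C_R_NormedModule) u x l -> is_derive (fun y => Re (u y)) x (Re l).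
Proof.
  intros H.
  exact (filterdiff_comp' (V := C_R_NormedModule) (W := R_NormedModule) u fst x _ fst H
    (filterdiff_linear _ (is_linear_fst (U := R_NormedModule) (V := R_NormedModule)))).
Qed.

Lemma is_derive_C_Im (u : R -> C) (x : R) (l : C) :
  is_derive (V := C_R_NormedModule) u x l -> is_derive (fun y => Im (u y)) x (Im l).
Proof.
  intros H.
  exact (filterdiff_comp' (V := C_R_NormedModule) (W := R_NormedModule) u snd x _ snd H
    (filterdiff_linear _ (is_linear_snd (U := R_NormedModule) (V := R_NormedModule)))).
Qed.

Lemma is_derive_C (u : R -> C) (x : R) (l : C) :
  is_derive (fun y => Re (u y)) x (Re l) -> is_derive (fun y => Im (u y)) x (Im l) ->
  is_derive (V := C_R_NormedModule) u x l.
Proof.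
  intros H1 H2.
  assert (L : filterdiff (U := R_NormedModule) (V := C_R_NormedModule)
    (fun y => (Re (u y), Im (u y))) (locally x)
    (fun y => (scal (V := R_NormedModule) y (Re l), scal (V := R_NormedModule) y (Im l)))).
  { apply (filterdiff_comp_2 (V := R_NormedModule) (W := C_R_NormedModule)
      (fun y => Re (u y)) (fun y => Im (u y)) (fun a c => (a, c)) _ _ (fun a c => (a, c)) H1 H2).
    apply (filterdiff_linear (V := C_R_NormedModule)).
    apply is_linear_prod; [apply is_linear_fst | apply is_linear_snd]. }
  unfold is_derive.
  apply (filterdiff_ext (U := R_NormedModule) (V := C_R_NormedModule) (fun y => (Re (u y), Im (u y)))).
  - intros y; destruct (u y); reflexivity.
  - exact L.
Qed.

Lemma is_derive_Cmult (c : C) (u : R -> C) (x : R) (l : C) :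
  is_derive (V := C_R_NormedModule) u x l ->
  is_derive (V := C_R_NormedModule) (fun y => c * u y)%C x (c * l)%C.
Proof.
  intros H; pose proof (is_derive_C_Re _ _ _ H) as H1; pose proof (is_derive_C_Im _ _ _ H) as H2.
  apply is_derive_C.
  - apply (is_derive_ext (fun y => minus (scal (Re c) (Re (u y))) (scal (Im c) (Im (u y))))).
    + intros y; destruct c, (u y); reflexivity.
    + replace (Re (c * l)%C) with (minus (scal (Re c) (Re l)) (scal (Im c) (Im l)))
        by (destruct c, l; reflexivity).
      apply (is_derive_minus (V := R_NormedModule)); apply (is_derive_scal (fun y => _)); assumption.
  - apply (is_derive_ext (fun y => plus (scal (Re c) (Im (u y))) (scal (Im c) (Re (u y))))).
    + intros y; destruct c, (u y); reflexivity.
    + replace (Im (c * l)%C) with (plus (scal (Re c) (Im l)) (scal (Im c) (Re l)))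
        by (destruct c, l; reflexivity).
      apply (is_derive_plus (V := R_NormedModule)); apply (is_derive_scal (fun y => _)); assumption.
Qed.

Lemma is_derive_Cplus (u v : R -> C) (x : R) (l m : C) :
  is_derive (V := C_R_NormedModule) u x l -> is_derive (V := C_R_NormedModule) v x m ->
  is_derive (V := C_R_NormedModule) (fun y => u y + v y)%C x (l + m)%C.
Proof. exact (is_derive_plus (V := C_R_NormedModule) u v x l m). Qed.

Lemma is_derive_Cexp (w : C) (x : R) :
  is_derive (V := C_R_NormedModule) (fun y => Cexp (w * RtoC y)%C) x (w * Cexp (w * RtoC x))%C.
Proof.
  apply is_derive_C; unfold Cexp; destruct w as [a c]; simpl;
    (auto_derive; [trivial |]); unfold Rminus; real_eq; ring.
Qed.

Lemma within_Icc_proper (b x : R) : 0 < x <= b -> ProperFilter (within (Icc b) (locally x)).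
Proof.
  intros Hx; split; [| apply within_filter, locally_filter].
  intros P [d Hd]; exists x; apply Hd; [apply ball_center | split; lra].
Qed.

(** A function on [0, b] is differentiable there as soon as some extension of it is. *)
Lemma is_deriv_of_is_derive (b x : R) (u v : R -> C) (l : C) : 0 < x <= b ->
  (forall y, 0 <= y <= b -> v y = u y) ->
  is_derive (V := C_R_NormedModule) v x l -> is_deriv b u x l.
Proof.
  intros Hx E H.
  pose proof (within_Icc_proper b x Hx) as PF.
  assert (Lx : is_filter_lim (within (Icc b) (locally x)) x).
  { intros P HP; apply (filter_le_within (Icc b) P HP). }
  unfold is_deriv.
  apply (filterdiff_ext_loc (U := R_NormedModule) (V := C_R_NormedModule) v).
  - exists (mkposreal 1 Rlt_0_1); intros y _ Hy; apply E, Hy.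
  - intros y Hy.
    assert (y = x) as ->.
    { apply (is_filter_lim_unique (V := R_NormedModule) (F := within (Icc b) (locally x))); assumption. }
    apply E; lra.
  - apply (filterdiff_locally (U := R_NormedModule) (V := C_R_NormedModule) v x); assumption.
Qed.

(** [x] is a limit of other points of [0, b], so difference quotients
    determine the derivative. *)
Lemma is_deriv_unique (b x : R) (u : R -> C) (l m : C) : 0 < x <= b ->
  is_deriv b u x l -> is_deriv b u x m -> l = m.
Proof.
  intros Hx Hl Hm.
  pose proof (within_Icc_proper b x Hx) as PF.
  assert (Lx : is_filter_lim (within (Icc b) (locally x)) x).
  { intros P HP; apply (filter_le_within (Icc b) P HP). }
  destruct Hl as [_ Hl]; destruct Hm as [_ Hm].
  specialize (Hl x Lx); specialize (Hm x Lx).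
  destruct (Req_dec (Cmod (l - m)%C) 0) as [E | E].
  { apply Cmod_eq_0 in E.
    replace l with ((l - m) + m)%C by ring; rewrite E; ring. }
  exfalso; pose proof (Cmod_ge_0 (l - m)%C) as P0.
  assert (He : 0 < Cmod (l - m)%C / 4) by lra.
  destruct (filter_and _ _ (Hl (mkposreal _ He)) (Hm (mkposreal _ He))) as [d Hd].
  pose proof (cond_pos d) as Pd.
  set (y := x - Rmin d x / 2).
  assert (Hy : 0 < Rmin d x) by (apply Rmin_glb_lt; lra).
  pose proof (Rmin_l d x); pose proof (Rmin_r d x).
  destruct (Hd y) as [H1 H2].
  { apply Rabs_lt_between; unfold minus, plus, opp, y; simpl; lra. }
  { unfold Icc, y; lra. }
  set (r := Rmin d x / 2) in *.
  set (a := (u y - u x - RtoC (- r) * l)%C).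
  set (c := (u y - u x - RtoC (- r) * m)%C).
  assert (Ey : y - x = - r) by (unfold y; ring).
  assert (Er : Rabs (y - x) = r) by (rewrite Ey, Rabs_Ropp, Rabs_pos_eq; unfold r; lra).
  assert (Ea : forall k, minus (minus (u y) (u x)) (scal (V := C_R_NormedModule) (minus y x) k)
                = (u y - u x - RtoC (- r) * k)%C).
  { intros k; replace (minus y x) with (- r) by (rewrite <- Ey; reflexivity).
    change (minus (minus (u y) (u x)) (scal (V := C_R_NormedModule) (- r) k))
      with (u y - u x - ((- r * Re k)%R, (- r * Im k)%R))%C.
    f_equal; f_equal; destruct k; unfold RtoC, Cmult; simpl; f_equal; ring. }
  assert (Ba : Cmod a <= Cmod (l - m)%C / 4 * Rabs (y - x)).
  { rewrite (Cmod_norm a); unfold a; rewrite <- Ea; exact H1. }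
  assert (Bc : Cmod c <= Cmod (l - m)%C / 4 * Rabs (y - x)).
  { rewrite (Cmod_norm c); unfold c; rewrite <- Ea; exact H2. }
  rewrite Er in Ba, Bc.
  assert (T : (c - a)%C = (RtoC (- r) * (l - m))%C) by (unfold a, c; ring).
  pose proof (Cmod_triangle c (- a)%C) as Tr; rewrite Cmod_opp in Tr.
  change (c + - a)%C with (c - a)%C in Tr; rewrite T, Cmod_mult, Cmod_R, Rabs_Ropp in Tr.
  rewrite Rabs_pos_eq in Tr by (unfold r; lra).
  assert (0 < r) by (unfold r; lra).
  nra.
Qed.

Lemma deriv_eq (b x : R) (u : R -> C) (l : C) : 0 < x <= b ->
  is_deriv b u x l -> deriv b u x = l.
Proof.
  intros Hx H; apply (is_deriv_unique b x u); [exact Hx | | exact H].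
  apply (epsilon_spec (inhabits (RtoC 0)) (is_deriv b u x)); exists l; exact H.
Qed.

Lemma continuous_on_Re {D : R * R -> Prop} (k : R -> R -> C) :
  continuous_on D (fun p => k (fst p) (snd p)) ->
  continuous_on D (fun p => Re (k (fst p) (snd p))).
Proof.
  intros H p Hp; eapply filterlim_comp; [exact (H p Hp) |].
  destruct (k (fst p) (snd p)) as [a c]; apply (continuous_fst (U := R_UniformSpace) (V := R_UniformSpace)).
Qed.

Lemma continuous_on_Im {D : R * R -> Prop} (k : R -> R -> C) :
  continuous_on D (fun p => k (fst p) (snd p)) ->
  continuous_on D (fun p => Im (k (fst p) (snd p))).
Proof.
  intros H p Hp; eapply filterlim_comp; [exact (H p Hp) |].
  destruct (k (fst p) (snd p)) as [a c]; apply (continuous_snd (U := R_UniformSpace) (V := R_UniformSpace)).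
Qed.

(** The real and imaginary parts of the product [K * g] are sums of four real kernels, to each
    of which Leibniz' rule applies. *)
Lemma is_derive_CInt_triangle (b : R) (K K1 : R -> R -> C) (g : R -> C) (x : R) :
  0 < b -> 0 < x <= b ->
  continuous_on (Defs.triangle b) (fun p => K (fst p) (snd p)) ->
  first_partial b K K1 ->
  (forall t, continuous (fun t => Re (g t)) t) -> (forall t, continuous (fun t => Im (g t)) t) ->
  exists G : R -> C, exists I : C,
    (forall y, 0 <= y <= b -> G y = CInt (fun t => K y t * g t)%C (- y) y) /\
    is_RInt (V := C_R_NormedModule) (fun t => (K1 x t * g t)%C) (- x) x I /\
    is_derive (V := C_R_NormedModule) G x (I + K x (- x)%R * g (- x)%R + K x x * g x)%C.
Proof.
  intros Hb Hx HK [HK1 Hd] Hr Hi.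
  pose proof (continuous_on_Re _ HK) as CKr; pose proof (continuous_on_Im _ HK) as CKi.
  pose proof (continuous_on_Re _ HK1) as C1r; pose proof (continuous_on_Im _ HK1) as C1i.
  assert (Dr : forall x t, x < b -> Rabs t < x -> is_derive (fun y => Re (K y t)) x (Re (K1 x t)))
    by (intros; apply is_derive_C_Re, Hd; assumption).
  assert (Di : forall x t, x < b -> Rabs t < x -> is_derive (fun y => Im (K y t)) x (Im (K1 x t)))
    by (intros; apply is_derive_C_Im, Hd; assumption).
  destruct (is_derive_RInt_triangle b (fun y t => Re (K y t)) (fun y t => Re (K1 y t)) (fun t => Re (g t)) x
    Hb Hx CKr C1r Dr Hr) as (Frr & Err & Irr & Hrr & Drr).
  destruct (is_derive_RInt_triangle b (fun y t => Im (K y t)) (fun y t => Im (K1 y t)) (fun t => Im (g t)) x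
    Hb Hx CKi C1i Di Hi) as (Fii & Eii & Iii & Hii & Dii).
  destruct (is_derive_RInt_triangle b (fun y t => Re (K y t)) (fun y t => Re (K1 y t)) (fun t => Im (g t)) x
    Hb Hx CKr C1r Dr Hi) as (Fri & Eri & Iri & Hri & Dri).
  destruct (is_derive_RInt_triangle b (fun y t => Im (K y t)) (fun y t => Im (K1 y t)) (fun t => Re (g t)) x
    Hb Hx CKi C1i Di Hr) as (Fir & Eir & Iir & Hir & Dir).
  exists (fun y => (Frr y - Fii y, Fri y + Fir y)), (Irr - Iii, Iri + Iir).
  split; [| split].
  - intros y Hy; symmetry; apply (is_RInt_unique (V := C_R_CompleteNormedModule)), is_RInt_C.
    + apply (is_RInt_minus (V := R_NormedModule) _ _ _ _ _ _ (Err y Hy) (Eii y Hy)).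
    + apply (is_RInt_plus (V := R_NormedModule) _ _ _ _ _ _ (Eri y Hy) (Eir y Hy)).
  - apply is_RInt_C.
    + apply (is_RInt_minus (V := R_NormedModule) _ _ _ _ _ _ Hrr Hii).
    + apply (is_RInt_plus (V := R_NormedModule) _ _ _ _ _ _ Hri Hir).
  - apply is_derive_C.
    + pose proof (is_derive_minus (V := R_NormedModule) _ _ _ _ _ Drr Dii) as D.
      match type of D with is_derive _ _ ?l => match goal with |- is_derive _ _ ?m =>
        replace m with l; [exact D |] end end.
      destruct (K x x), (K x (- x)), (g x), (g (- x)).
      unfold minus, plus, opp; simpl; real_eq; ring.
    + pose proof (is_derive_plus (V := R_NormedModule) _ _ _ _ _ Dri Dir) as D.
      match type of D with is_derive _ _ ?l => match goal with |- is_derive _ _ ?m =>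
        replace m with l; [exact D |] end end.
      destruct (K x x), (K x (- x)), (g x), (g (- x)).
      unfold minus, plus, opp; simpl; real_eq; ring.
Qed.

Lemma CInt_point (u : R -> C) (a : R) : CInt u a a = RtoC 0.
Proof. exact (RInt_point (V := C_R_CompleteNormedModule) a u). Qed.

Lemma CInt_zero (u : R -> C) (a c : R) : (forall t, u t = RtoC 0) -> CInt u a c = RtoC 0.
Proof.
  intros H; apply (is_RInt_unique (V := C_R_CompleteNormedModule)).
  apply (is_RInt_ext (V := C_R_NormedModule) (fun _ => RtoC 0)); [intros; symmetry; apply H |].
  assert (Z : scal (V := C_R_NormedModule) (c - a) (RtoC 0) = RtoC 0)
    by exact (scal_zero_r (V := C_R_NormedModule) (c - a)).
  exact (eq_ind _ (is_RInt (V := C_R_NormedModule) (fun _ => RtoC 0) a c)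
    (is_RInt_const (V := C_R_NormedModule) a c (RtoC 0)) _ Z).
Qed.

(** On each of the sides [t = x] and [t = - x] one of the two integrations in the integral
    equation runs over a point. *)
Lemma kernel_diag (b : R) (q : R -> C) (h : C) (K : R -> R -> C) (x : R) :
  transmutation_kernel b q h K -> 0 <= x <= b ->
  K x x = (h / 2 + / 2 * CInt q 0 x)%C /\ K x (- x) = (h / 2)%C.
Proof.
  intros [_ H] Hx; split.
  - rewrite H by (rewrite ?Rabs_pos_eq; lra).
    replace ((x + x) / 2) with x by field; replace ((x - x) / 2) with 0 by field.
    rewrite (CInt_zero (fun al => CInt _ 0 0)) by (intros; apply CInt_point).
    apply Cplus_0_r.
  - rewrite H by (rewrite ?Rabs_Ropp, ?Rabs_pos_eq; lra).
    replace ((x + - x) / 2) with 0 by field; rewrite !CInt_point, Cmult_0_r, !Cplus_0_r; reflexivity.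
Qed.

(** * Bounds on the cosine and the sine in a strip *)

(** With [d = |a|], [cosh c - cosh d] has the sign of
    [(exp c - exp d) * (1 - exp (- c) * exp (- d))]. *)
Lemma cosh_le (a c : R) : Rabs a <= c -> cosh a <= cosh c.
Proof.
  intros H; unfold cosh.
  assert (E : exp a + exp (- a) = exp (Rabs a) + exp (- Rabs a)).
  { unfold Rabs; destruct (Rcase_abs a); [rewrite Ropp_involutive; ring | reflexivity]. }
  rewrite E; pose proof (Rabs_pos a) as P; set (d := Rabs a) in *.
  assert (1 <= exp d) by (pose proof (exp_ineq1_le d); lra).
  assert (exp d <= exp c).
  { destruct (Rle_lt_or_eq_dec d c H) as [L | ->]; [left; apply exp_increasing, L | lra]. }
  assert (Ed : exp d * exp (- d) = 1) by (rewrite <- exp_plus, Rplus_opp_r; apply exp_0).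
  assert (Ec : exp c * exp (- c) = 1) by (rewrite <- exp_plus, Rplus_opp_r; apply exp_0).
  pose proof (exp_pos (- d)); pose proof (exp_pos (- c)).
  assert (exp (- c) <= 1) by nra; assert (exp (- d) <= 1) by nra.
  assert (exp (- d) - exp (- c) = (exp c - exp d) * (exp (- d) * exp (- c))).
  { transitivity (exp c * exp (- c) * exp (- d) - exp d * exp (- d) * exp (- c)); [rewrite Ed, Ec; ring | ring]. }
  assert (exp (- d) * exp (- c) <= 1) by nra.
  nra.
Qed.

Lemma is_RInt_cosh (A x : R) :
  is_RInt (fun t => cosh (A * t)) (- x) x (2 * sinh_quot A x).
Proof.
  unfold sinh_quot; destruct (Req_EM_T A 0) as [-> | HA].
  - apply (is_RInt_ext (fun _ => 1)).
    + intros t _; rewrite Rmult_0_l; symmetry; apply cosh_0.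
    + replace (2 * x) with (scal (x - - x) 1) by (unfold scal; simpl; unfold mult; simpl; ring).
      apply (is_RInt_const (V := R_NormedModule)).
  - replace (2 * (sinh (A * x) / A)) with (minus (sinh (A * x) / A) (sinh (A * - x) / A)).
    2: { unfold minus, plus, opp, sinh; simpl.
         replace (- (A * - x)) with (A * x) by ring.
         replace (A * - x) with (- (A * x)) by ring; field; exact HA. }
    apply (is_RInt_derive (V := R_CompleteNormedModule) (fun t => sinh (A * t) / A)).
    + intros t _; unfold sinh, cosh; auto_derive; [trivial |]; real_eq; field; exact HA.
    + intros t _; apply continuous_of_derivable; unfold cosh; auto_derive; trivial.
Qed.

Lemma Cmod_Cexp (z : C) : Cmod (Cexp z) = exp (Re z).
Proof.
  unfold Cexp, Cmod; simpl fst; simpl snd.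
  replace ((exp (Re z) * cos (Im z)) ^ 2 + (exp (Re z) * sin (Im z)) ^ 2)
    with (exp (Re z) * exp (Re z) * (Rsqr (sin (Im z)) + Rsqr (cos (Im z)))) by (unfold Rsqr; ring).
  rewrite sin2_cos2, Rmult_1_r; apply sqrt_square; left; apply exp_pos.
Qed.

Lemma Cmod_Ccos (z : C) : Cmod (Ccos z) <= cosh (Im z).
Proof.
  unfold Ccos, Cdiv; rewrite Cmod_mult, Cmod_inv by (apply RtoC_neq_0; lra).
  rewrite Cmod_R, Rabs_pos_eq by lra.
  pose proof (Cmod_triangle (Cexp (Ci * z)) (Cexp (- (Ci * z)))) as T.
  rewrite !Cmod_Cexp in T.
  replace (Re (Ci * z)%C) with (- Im z) in T by (destruct z; simpl; ring).
  replace (Re (- (Ci * z))%C) with (Im z) in T by (destruct z; simpl; ring).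
  unfold cosh; lra.
Qed.

Lemma Ci_neq_0 : Ci <> RtoC 0.
Proof. intros E; apply (f_equal Im) in E; simpl in E; lra. Qed.

Lemma Cmod_Csin (z : C) : Cmod (Csin z) <= cosh (Im z).
Proof.
  unfold Csin, Cdiv; rewrite Cmod_mult, Cmod_inv
    by (apply Cmult_neq_0; [apply RtoC_neq_0; lra | apply Ci_neq_0]).
  rewrite Cmod_mult, Cmod_R, Rabs_pos_eq by lra.
  replace (Cmod Ci) with 1 by (symmetry; transitivity (sqrt 1); [unfold Cmod; simpl; f_equal; ring | apply sqrt_1]).
  pose proof (Cmod_triangle (Cexp (Ci * z)) (- Cexp (- (Ci * z)))%C) as T.
  rewrite Cmod_opp, !Cmod_Cexp in T.
  replace (Re (Ci * z)%C) with (- Im z) in T by (destruct z; simpl; ring).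
  replace (Re (- (Ci * z))%C) with (Im z) in T by (destruct z; simpl; ring).
  unfold cosh, Cminus; lra.
Qed.

Lemma trig_bound (w : C) (A t : R) (g : C -> C) :
  (forall z, Cmod (g z) <= cosh (Im z)) -> Rabs (Im w) <= A ->
  Cmod (g (w * RtoC t)%C) <= cosh (A * t).
Proof.
  intros Hg HA; eapply Rle_trans; [apply Hg |].
  rewrite im_scal_r.
  assert (E : cosh (A * t) = cosh (A * Rabs t)).
  { unfold Rabs; destruct (Rcase_abs t); [| reflexivity].
    replace (A * - t) with (- (A * t)) by ring; unfold cosh; rewrite Ropp_involutive; lra. }
  rewrite E; apply cosh_le; rewrite Rabs_mult.
  apply Rmult_le_compat_r; [apply Rabs_pos | exact HA].
Qed.

(** * Cosine and sine against Legendre sums *)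

(** The cosine and the sine are both of this shape, so the estimate is carried out once. *)
Definition trig (al be z : C) : C := (al * Cexp (Ci * z) + be * Cexp (- (Ci * z)))%C.

Lemma Ci_sq : (Ci * Ci = - (1))%C.
Proof. unfold Ci, Cmult, Copp, RtoC; simpl; f_equal; ring. Qed.

Lemma Cinv_2Ci : (/ (2 * Ci) = - Ci / 2)%C.
Proof.
  transitivity (/ (2 * Ci) * (- (Ci * Ci)))%C; [rewrite Ci_sq; ring |].
  field; apply Ci_neq_0.
Qed.

Lemma Ccos_trig (z : C) : Ccos z = trig (/ 2) (/ 2) z.
Proof. unfold Ccos, trig; field. Qed.

Lemma Csin_trig (z : C) : Csin z = trig (- Ci / 2) (Ci / 2) z.
Proof. unfold Csin, trig, Cdiv at 1; rewrite Cinv_2Ci; field. Qed.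

Lemma is_derive_trig (al be w : C) (x : R) :
  is_derive (V := C_R_NormedModule) (fun y => trig al be (w * RtoC y)%C) x
    (w * trig (Ci * al) (- Ci * be) (w * RtoC x))%C.
Proof.
  replace (w * trig (Ci * al) (- Ci * be) (w * RtoC x))%C
    with (al * (Ci * w * Cexp (Ci * w * RtoC x)) + be * (- (Ci * w) * Cexp (- (Ci * w) * RtoC x)))%C.
  - eapply (is_derive_ext (V := C_R_NormedModule));
      [| apply is_derive_Cplus; apply is_derive_Cmult, is_derive_Cexp].
    intros y; unfold trig; f_equal; f_equal; f_equal; ring.
  - unfold trig.
    replace (Ci * (w * RtoC x))%C with (Ci * w * RtoC x)%C by ring.
    replace (- (Ci * w * RtoC x))%C with (- (Ci * w) * RtoC x)%C by ring; ring.
Qed.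

Lemma is_RInt_legendre_trig (n : nat) (al be z : C) : z <> RtoC 0 ->
  is_RInt (V := C_R_NormedModule) (fun u => RtoC (legendre n u) * trig al be (z * RtoC u))%C (-1) 1
    (2 * (al * Ci ^ n + be * (- Ci) ^ n) * sphj n z)%C.
Proof.
  intros Hz.
  pose proof (is_RInt_fourier_legendre n (Ci * z)%C) as H1.
  pose proof (is_RInt_fourier_legendre n (- Ci * z)%C) as H2.
  rewrite fourier_legendre_sphj in H1 by (exact Ci_sq || exact Hz).
  rewrite fourier_legendre_sphj in H2 by (exact Hz || (rewrite <- Ci_sq; ring)).
  replace (2 * (al * Ci ^ n + be * (- Ci) ^ n) * sphj n z)%C
    with (al * (2 * Ci ^ n * sphj n z) + be * (2 * (- Ci) ^ n * sphj n z))%C by ring.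
  eapply (is_RInt_ext (V := C_R_NormedModule));
    [| apply is_RInt_Cplus; apply is_RInt_Cmult; [exact H1 | exact H2]].
  intros u _; unfold trig.
  replace (Ci * (z * RtoC u))%C with (Ci * z * RtoC u)%C by ring.
  replace (- (Ci * z * RtoC u))%C with (- Ci * z * RtoC u)%C by ring.
  complex_eq; ring.
Qed.

(** The factor [1 / x] of the truncated kernel is exactly the Jacobian of [t = x u]. *)
Lemma is_RInt_legendre_trig_scaled (n : nat) (al be w : C) (x : R) :
  0 < x -> w <> RtoC 0 ->
  is_RInt (V := C_R_NormedModule)
    (fun t => / RtoC x * (RtoC (legendre n (t / x)) * trig al be (w * RtoC t)))%C (- x) x
    (2 * (al * Ci ^ n + be * (- Ci) ^ n) * sphj n (w * RtoC x))%C.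
Proof.
  intros Hx Hw.
  assert (Hx0 : RtoC x <> RtoC 0) by (apply RtoC_neq_0; lra).
  pose proof (is_RInt_legendre_trig n al be (w * RtoC x)%C (Cmult_neq_0 _ _ Hw Hx0)) as H.
  eapply (is_RInt_ext (V := C_R_NormedModule));
    [| apply (is_RInt_comp_lin (V := C_R_NormedModule)
         (fun u => RtoC (legendre n u) * trig al be (w * RtoC x * RtoC u))%C (/ x) 0);
       replace (/ x * - x + 0) with (-1) by (field; lra);
       replace (/ x * x + 0) with 1 by (field; lra); exact H].
  intros t _; cbv beta.
  replace (/ x * t + 0) with (t / x) by (field; lra).
  replace (w * RtoC x * RtoC (t / x))%C with (w * RtoC t)%C
    by (rewrite RtoC_div by lra; field; exact Hx0).
  rewrite <- RtoC_inv by lra.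
  destruct (RtoC (legendre n (t / x)) * trig al be (w * RtoC t))%C as [y1 y2].
  unfold scal; simpl; unfold prod_scal, scal; simpl; unfold mult, Cmult, RtoC; simpl.
  f_equal; real_eq; ring.
Qed.

(** The integral over [- x, x] of a Legendre sum with coefficients [c j / x] against
    [trig al be (w t)], expressed by spherical Bessel functions. *)
Definition legendre_sum_integral (c : nat -> C) (al be w : C) (x : R) (N : nat) : C :=
  sum_n (fun j => c j * (2 * (al * Ci ^ j + be * (- Ci) ^ j) * sphj j (w * RtoC x)))%C N.

Lemma is_RInt_legendre_sum (c : nat -> C) (N : nat) (al be w : C) (x : R) :
  0 < x -> w <> RtoC 0 ->
  is_RInt (V := C_R_NormedModule)
    (fun t => sum_n (fun j => c j / RtoC x * RtoC (legendre j (t / x)))%C N * trig al be (w * RtoC t))%C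
    (- x) x (legendre_sum_integral c al be w x N).
Proof.
  intros Hx Hw; unfold legendre_sum_integral.
  assert (T : forall j, is_RInt (V := C_R_NormedModule)
    (fun t => (c j / RtoC x * RtoC (legendre j (t / x))) * trig al be (w * RtoC t))%C
    (- x) x (c j * (2 * (al * Ci ^ j + be * (- Ci) ^ j) * sphj j (w * RtoC x)))%C).
  { intros j.
    eapply (is_RInt_ext (V := C_R_NormedModule));
      [| apply is_RInt_Cmult, is_RInt_legendre_trig_scaled; assumption].
    intros t _; cbv beta; complex_eq.
    unfold Cdiv; ring. }
  induction N as [| N IH].
  - rewrite sum_O.
    apply (is_RInt_ext (V := C_R_NormedModule)) with (2 := T 0%nat).
    intros t _; rewrite sum_O; reflexivity.
  - rewrite sum_Sn.
    apply (is_RInt_ext (V := C_R_NormedModule)) with (2 := is_RInt_Cplus _ _ _ _ _ _ IH (T (S N))).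
    intros t _; rewrite sum_Sn; cbv beta.
    complex_eq.
    change plus with Cplus; ring.
Qed.

Lemma sum_n_succ_C (a : nat -> C) (n : nat) : sum_n a (S n) = (sum_n a n + a (S n))%C.
Proof. exact (sum_Sn a n). Qed.

Lemma half_succ (n : nat) :
  (S n / 2 = n / 2 /\ S n = 2 * (n / 2) + 1)%nat \/ (S n / 2 = S (n / 2) /\ S n = 2 * S (n / 2))%nat.
Proof.
  destruct (Nat.Even_or_Odd n) as [[k E] | [k E]]; subst n.
  - left; replace (S (2 * k)) with (1 + k * 2)%nat by lia.
    rewrite Nat.div_add by lia; replace (2 * k)%nat with (k * 2)%nat by lia.
    rewrite Nat.div_mul by lia; simpl; lia.
  - right; replace (S (2 * k + 1)) with (S k * 2)%nat by lia.
    rewrite Nat.div_mul by lia; replace (2 * k + 1)%nat with (1 + k * 2)%nat by lia.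
    rewrite Nat.div_add by lia; simpl; lia.
Qed.

Lemma sum_n_even (a : nat -> C) (N : nat) :
  (forall m, a (2 * m + 1)%nat = RtoC 0) ->
  sum_n a N = sum_n (fun m => a (2 * m)%nat) (N / 2).
Proof.
  intros H; induction N as [| N IH]; [rewrite !sum_O; reflexivity |].
  rewrite sum_n_succ_C, IH.
  destruct (half_succ N) as [[E1 E2] | [E1 E2]]; rewrite E1.
  - rewrite E2, H; apply Cplus_0_r.
  - rewrite sum_n_succ_C, <- E2; reflexivity.
Qed.

Lemma sum_n_odd (a : nat -> C) (N : nat) :
  (forall m, a (2 * m)%nat = RtoC 0) ->
  sum_n a N = match N with
              | O => RtoC 0
              | S M => sum_n (fun m => a (2 * m + 1)%nat) (M / 2)
              end.
Proof.
  intros H; destruct N as [| M]; [rewrite sum_O; apply (H 0%nat) |].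
  induction M as [| M IH].
  - rewrite sum_n_succ_C, !sum_O, (H 0%nat : a 0%nat = RtoC 0); apply Cplus_0_l.
  - rewrite sum_n_succ_C, IH.
    destruct (half_succ M) as [[E1 E2] | [E1 E2]]; rewrite E1.
    + replace (S (S M)) with (2 * S (M / 2))%nat by lia; rewrite H; apply Cplus_0_r.
    + rewrite sum_n_succ_C; f_equal; f_equal; lia.
Qed.

Lemma sum_n_Cmult (c : C) (a : nat -> C) (n : nat) :
  sum_n (fun m => c * a m)%C n = (c * sum_n a n)%C.
Proof.
  induction n as [| n IH]; [rewrite !sum_O; reflexivity |].
  rewrite !sum_n_succ_C, IH; complex_eq; ring.
Qed.

Lemma Ci_pow_even (m : nat) : (Ci ^ (2 * m))%C = RtoC ((-1) ^ m).
Proof.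
  rewrite Cpow_mult_r, RtoC_pow; f_equal; simpl.
  rewrite Cmult_1_r, Ci_sq; unfold RtoC, Copp; simpl; f_equal; ring.
Qed.

Lemma Copp_Ci_pow_even (m : nat) : ((- Ci) ^ (2 * m))%C = RtoC ((-1) ^ m).
Proof.
  rewrite <- Ci_pow_even, !Cpow_mult_r; f_equal; simpl; ring.
Qed.

(** For odd [j] the factors [i^j] and [(- i)^j] cancel; for [j = 2 n] both are [(- 1)^n]. *)
Lemma legendre_sum_integral_cos (c : nat -> C) (w : C) (x : R) (N : nat) :
  legendre_sum_integral c (/ 2) (/ 2) w x N =
  (2 * sum_n (fun n => RtoC ((-1) ^ n) * c (2 * n)%nat * sphj (2 * n) (w * RtoC x)) (N / 2))%C.
Proof.
  unfold legendre_sum_integral; rewrite sum_n_even, <- sum_n_Cmult.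
  - apply sum_n_ext; intros m.
    rewrite Ci_pow_even, Copp_Ci_pow_even.
    complex_eq; field.
  - intros m; rewrite !Cpow_add_r, Ci_pow_even, Copp_Ci_pow_even, !Cpow_1_r; field.
Qed.

(** For even [j] the terms cancel; for [j = 2 n + 1] the factor [- i / 2] of the sine turns
    [i^j - (- i)^j] into [(- 1)^n]. *)
Lemma legendre_sum_integral_sin (c : nat -> C) (w : C) (x : R) (N : nat) :
  legendre_sum_integral c (- Ci / 2) (Ci / 2) w x N =
  (2 * match N with
       | O => RtoC 0
       | S M => sum_n (fun n => RtoC ((-1) ^ n) * c (2 * n + 1)%nat * sphj (2 * n + 1) (w * RtoC x)) (M / 2)
       end)%C.
Proof.
  unfold legendre_sum_integral; rewrite sum_n_odd.
  - destruct N as [| M]; [ring |].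
    rewrite <- sum_n_Cmult; apply sum_n_ext; intros m.
    rewrite !Cpow_add_r, Ci_pow_even, Copp_Ci_pow_even, !Cpow_1_r.
    complex_eq.
    transitivity (2 * (RtoC ((-1) ^ m) * c (2 * m + 1)%nat * sphj (2 * m + 1) (w * RtoC x)) * (- (Ci * Ci)))%C.
    + field.
    + rewrite Ci_sq; ring.
  - intros m; rewrite Ci_pow_even, Copp_Ci_pow_even; field.
Qed.

(** * The error estimate *)

(** In the derivative of the transform, only the integral of [K1] is approximated, so the error
    is the integral of [(K1 - K2) * trig], and [cosh (A t)] majorises the trigonometric
    factor. *)
Lemma transform_estimate (b : R) (K K1 K2 : R -> R -> C) (w al be S : C) (x A e : R) :
  0 < b -> 0 < x <= b ->
  continuous_on (Defs.triangle b) (fun p => K (fst p) (snd p)) ->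
  first_partial b K K1 ->
  (forall t, Cmod (trig al be (w * RtoC t)%C) <= cosh (A * t)) ->
  (forall t, Rabs t <= x -> Cmod (K1 x t - K2 x t)%C <= e) ->
  is_RInt (V := C_R_NormedModule) (fun t => K2 x t * trig al be (w * RtoC t))%C (- x) x S ->
  let u := fun y => (trig al be (w * RtoC y) + CInt (fun t => K y t * trig al be (w * RtoC t)) (- y)%R y)%C in
  ex_deriv b u x /\
  Cmod (deriv b u x - (w * trig (Ci * al) (- Ci * be) (w * RtoC x)
    + K x (- x)%R * trig al be (w * RtoC (- x)) + K x x * trig al be (w * RtoC x) + S))%C
  <= 2 * e * sinh_quot A x.
Proof.
  intros Hb Hx HK HK1 Hg He HS u.
  set (g := fun t => trig al be (w * RtoC t)%C) in *.
  assert (Dg : forall t, is_derive (V := C_R_NormedModule) g t (w * trig (Ci * al) (- Ci * be) (w * RtoC t))%C)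
    by (intros t; apply is_derive_trig).
  assert (Cr : forall t, continuous (fun t => Re (g t)) t).
  { intros t; apply continuous_of_derivable; eexists; apply (is_derive_C_Re _ _ _ (Dg t)). }
  assert (Cim : forall t, continuous (fun t => Im (g t)) t).
  { intros t; apply continuous_of_derivable; eexists; apply (is_derive_C_Im _ _ _ (Dg t)). }
  destruct (is_derive_CInt_triangle b K K1 g x Hb Hx HK HK1 Cr Cim) as (G & I & EG & HI & DG).
  assert (D : is_deriv b u x (w * trig (Ci * al) (- Ci * be) (w * RtoC x)
                + (I + K x (- x)%R * g (- x)%R + K x x * g x))%C).
  { apply (is_deriv_of_is_derive b x u (fun y => g y + G y)%C); [exact Hx | |].
    - intros y Hy; rewrite EG by exact Hy; reflexivity.
    - apply is_derive_Cplus; [apply Dg | exact DG]. }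
  split; [eexists; exact D |].
  rewrite (deriv_eq b x u _ Hx D).
  fold (g x); fold (g (- x)).
  match goal with |- Cmod ?z <= _ => replace z with (I - S)%C by ring end.
  replace (2 * e * sinh_quot A x) with (scal e (2 * sinh_quot A x))
    by (unfold scal; simpl; unfold mult; simpl; ring).
  rewrite Cmod_norm.
  apply (norm_RInt_le (V := C_R_NormedModule)
    (fun t => minus (K1 x t * g t)%C (K2 x t * g t)%C) (fun t => scal e (cosh (A * t))) (- x) x); [lra | | |].
  - intros t Ht.
    assert (Q : Cmod (K1 x t * g t - K2 x t * g t)%C <= e * cosh (A * t)).
    { replace (K1 x t * g t - K2 x t * g t)%C with ((K1 x t - K2 x t) * g t)%C by ring.
      rewrite Cmod_mult.
      apply Rmult_le_compat; try apply Cmod_ge_0; [| apply Hg].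
      apply He, Rabs_le; lra. }
    rewrite Cmod_norm in Q; exact Q.
  - apply (is_RInt_minus (V := C_R_NormedModule)); [exact HI | exact HS].
  - apply (is_RInt_scal (V := R_NormedModule)), is_RInt_cosh.
Qed.

Lemma csol_trig (K : R -> R -> C) (w : C) : csol K w = fun y =>
  (trig (/ 2) (/ 2) (w * RtoC y) + CInt (fun t => K y t * trig (/ 2) (/ 2) (w * RtoC t)) (- y)%R y)%C.
Proof.
  apply functional_extensionality; intros y; unfold csol; rewrite Ccos_trig.
  f_equal; f_equal; apply functional_extensionality; intros t; rewrite Ccos_trig; reflexivity.
Qed.

Lemma ssol_trig (K : R -> R -> C) (w : C) : ssol K w = fun y =>
  (trig (- Ci / 2) (Ci / 2) (w * RtoC y)
   + CInt (fun t => K y t * trig (- Ci / 2) (Ci / 2) (w * RtoC t)) (- y)%R y)%C.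
Proof.
  apply functional_extensionality; intros y; unfold ssol; rewrite Csin_trig.
  f_equal; f_equal; apply functional_extensionality; intros t; rewrite Csin_trig; reflexivity.
Qed.

Lemma csol_estimate (b : R) (q f : R -> C) (h : C) (K K1 : R -> R -> C) (N : nat)
    (eps : R -> R) (x : R) (w : C) (A : R) :
  0 < b -> transmutation_kernel b q h K -> first_partial b K K1 ->
  (forall x t, 0 < x <= b -> Rabs t <= x -> Cmod (K1 x t - K1N b q f h N x t)%C <= eps x) ->
  0 < x <= b -> w <> RtoC 0 -> Rabs (Im w) <= A ->
  ex_deriv b (csol K w) x /\
  Cmod (deriv b (csol K w) x - c_ring b q f h N w x)%C <= 2 * eps x * sinh_quot A x.
Proof.
  intros hb hK hK1 heps Hx Hw HA.
  destruct (transform_estimate b K K1 (K1N b q f h N) w (/ 2) (/ 2)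
    (legendre_sum_integral (fun j => gamma b q f h j x) (/ 2) (/ 2) w x N) x A (eps x)) as [E B];
    try assumption.
  - apply hK.
  - intros t; rewrite <- Ccos_trig; apply (trig_bound w A t Ccos); [apply Cmod_Ccos | exact HA].
  - intros t Ht; apply heps; assumption.
  - apply is_RInt_legendre_sum; [apply Hx | exact Hw].
  - rewrite csol_trig; split; [exact E |].
    match type of B with Cmod (_ - ?l)%C <= _ => replace (c_ring b q f h N w x) with l; [exact B |] end.
    destruct (kernel_diag b q h K x hK) as [-> ->]; [lra |].
    rewrite legendre_sum_integral_cos; unfold c_ring; rewrite Ccos_trig, Csin_trig.
    f_equal; unfold trig.
    replace (Ci * (w * RtoC (- x)))%C with (- (Ci * (w * RtoC x)))%C by (rewrite RtoC_opp; ring).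
    replace (- - (Ci * (w * RtoC x)))%C with (Ci * (w * RtoC x))%C by ring.
    field.
Qed.

Lemma ssol_estimate (b : R) (q f : R -> C) (h : C) (K K1 : R -> R -> C) (N : nat)
    (eps : R -> R) (x : R) (w : C) (A : R) :
  0 < b -> transmutation_kernel b q h K -> first_partial b K K1 ->
  (forall x t, 0 < x <= b -> Rabs t <= x -> Cmod (K1 x t - K1N b q f h N x t)%C <= eps x) ->
  0 < x <= b -> w <> RtoC 0 -> Rabs (Im w) <= A ->
  ex_deriv b (ssol K w) x /\
  Cmod (deriv b (ssol K w) x - s_ring b q f h N w x)%C <= 2 * eps x * sinh_quot A x.
Proof.
  intros hb hK hK1 heps Hx Hw HA.
  destruct (transform_estimate b K K1 (K1N b q f h N) w (- Ci / 2) (Ci / 2)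
    (legendre_sum_integral (fun j => gamma b q f h j x) (- Ci / 2) (Ci / 2) w x N) x A (eps x)) as [E B];
    try assumption.
  - apply hK.
  - intros t; rewrite <- Csin_trig; apply (trig_bound w A t Csin); [apply Cmod_Csin | exact HA].
  - intros t Ht; apply heps; assumption.
  - apply is_RInt_legendre_sum; [apply Hx | exact Hw].
  - rewrite ssol_trig; split; [exact E |].
    match type of B with Cmod (_ - ?l)%C <= _ => replace (s_ring b q f h N w x) with l; [exact B |] end.
    destruct (kernel_diag b q h K x hK) as [-> ->]; [lra |].
    rewrite legendre_sum_integral_sin; unfold s_ring; rewrite Ccos_trig, Csin_trig.
    f_equal; unfold trig.
    replace (Ci * (w * RtoC (- x)))%C with (- (Ci * (w * RtoC x)))%C by (rewrite RtoC_opp; ring).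
    replace (- - (Ci * (w * RtoC x)))%C with (Ci * (w * RtoC x))%C by ring.
    replace (Ci * (- Ci / 2))%C with (/ 2)%C
      by (transitivity (- (Ci * Ci) / 2)%C; [rewrite Ci_sq; field | field]).
    replace (- Ci * (Ci / 2))%C with (/ 2)%C
      by (transitivity (- (Ci * Ci) / 2)%C; [rewrite Ci_sq; field | field]).
    field.
Qed.

Theorem mainTheorem8
    (b : R) (q f : R -> C) (h : C) (K K1 : R -> R -> C)
    (N : nat) (eps : R -> R)
    (hb : 0 < b)
    (hq : continuous_on (Icc b) q)
    (hf : schrodinger_sol b q f)
    (hf_nz : forall x, 0 <= x <= b -> f x <> RtoC 0)
    (hf0 : f 0 = RtoC 1)
    (hh : is_deriv b f 0 h)
    (hK : transmutation_kernel b q h K)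
    (hK1 : first_partial b K K1)
    (heps_nonneg : forall x, 0 < x <= b -> 0 <= eps x)
    (heps : forall x t, 0 < x <= b -> Rabs t <= x ->
      Cmod (K1 x t - K1N b q f h N x t)%C <= eps x) :
  forall x, 0 < x <= b ->
    (forall w : C, w <> RtoC 0 ->
      ex_deriv b (csol K w) x /\ ex_deriv b (ssol K w) x) /\
    (forall w : R, w <> 0 ->
      Cmod (deriv b (csol K (RtoC w)) x - c_ring b q f h N (RtoC w) x)%C
        <= 2 * Rabs x * eps x /\
      Cmod (deriv b (ssol K (RtoC w)) x - s_ring b q f h N (RtoC w) x)%C
        <= 2 * Rabs x * eps x) /\
    (forall (w : C) (A : R), w <> RtoC 0 -> 0 <= A -> Rabs (Im w) <= A ->
      Cmod (deriv b (csol K w) x - c_ring b q f h N w x)%C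
        <= 2 * eps x * sinh_quot A x /\
      Cmod (deriv b (ssol K w) x - s_ring b q f h N w x)%C
        <= 2 * eps x * sinh_quot A x).
Proof.
  intros x Hx.
  assert (EC := fun w A => csol_estimate b q f h K K1 N eps x w A hb hK hK1 heps).
  assert (ES := fun w A => ssol_estimate b q f h K K1 N eps x w A hb hK hK1 heps).
  split; [| split].
  - intros w Hw; split.
    + apply (EC w (Rabs (Im w)) Hx Hw (Rle_refl _)).
    + apply (ES w (Rabs (Im w)) Hx Hw (Rle_refl _)).
  - intros w Hw.
    assert (Hw' : RtoC w <> RtoC 0) by (apply RtoC_neq_0, Hw).
    assert (HA : Rabs (Im (RtoC w)) <= 0) by (simpl; rewrite Rabs_R0; lra).
    assert (E : 2 * Rabs x * eps x = 2 * eps x * sinh_quot 0 x).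
    { unfold sinh_quot; destruct (Req_EM_T 0 0) as [_ | F]; [| now elim F].
      rewrite Rabs_pos_eq by lra; ring. }
    (* The real axis is the strip of width [A = 0], where [sinh_quot] is [x]. *)
    rewrite E; split; [apply EC | apply ES]; assumption.
  - intros w A Hw _ HA; split; [apply EC | apply ES]; assumption.
Qed.
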